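(* Let $J\subseteq S$ with $|J|=1$. Then $\mathcal{L}_J$ (ordered by inclusion) is a complete meet semilattice of subsets of $\Lambda:=\Lambda_J$. Further: (a) If $Y\subseteq\mathcal{L}_J$ has an upper bound in $\mathcal{L}_J$, then it has a join $\Delta:=\bigvee Y$ in $\mathcal{L}_J$, given by $\Delta=\overline{\bigcup_{\Gamma\in Y}\Gamma}$. (b) The meet $\Delta$ of a non-empty subset $Y$ of $\mathcal{L}_J$ is given by $\Lambda\setminus\Delta=\overline{\bigcup_{\Gamma\in Y}(\Lambda\setminus\Gamma)}$. (c) The map $\Gamma\mapsto\tau(\Gamma)$ maps $\mathcal{L}_J$ into the lattice of finite biclosed subsets of $\Phi_J$ (with biclosed sets ordered by inclusion), preserving meets and those joins which exist. Moreover, $\tau(\overline{\Gamma})=\overline{\tau(\Gamma)}$ for any $\Gamma\subseteq\Lambda$.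
   Context: Setting: $V$ is a real vector space with a symmetric bilinear form $\langle\cdot,\cdot\rangle$ and $\Pi\subseteq V$ is a set (the simple roots, possibly infinite) such that (i) $\Pi$ is positively independent (if a finite sum $\sum_{\alpha\in\Pi}c_\alpha\alpha=0$ with all $c_\alpha\geq 0$, then all $c_\alpha=0$); (ii) $\langle\alpha,\alpha\rangle=1$ for $\alpha\in\Pi$, and $\langle\alpha,\beta\rangle\in\{-\cos(\pi/m)\mid m\in\mathbb{Z}_{\geq 2}\}\cup(-\infty,-1]$ for distinct $\alpha,\beta\in\Pi$. For $\alpha\in V$ with $\langle\alpha,\alpha\rangle=1$, let $s_\alpha(v)=v-2\langle v,\alpha\rangle\alpha$. Then $S=\{s_\alpha\mid\alpha\in\Pi\}$, $W=\langle S\rangle$ is a Coxeter group with Coxeter system $(W,S)$. The root system is $\Phi=W\Pi$; the positive roots $\Phi_+$ are the roots that are non-negative real linear combinations of $\Pi$; $\Phi$ is the disjoint union of $\Phi_+$ and $-\Phi_+$. 2-closure: a subset $\Gamma$ of $\Phi$ is closed if for all $\alpha,\beta\in\Gamma$, $\{a\alpha+b\beta\mid a,b\in\mathbb{R}_{\geq0}\}\cap\Phi\subseteq\Gamma$. For $\Gamma\subseteq\Phi$, $\overline{\Gamma}$ is the intersection of all closed subsets of $\Phi$ containing $\Gamma$. For a closed subset $\Lambda$ of $\Phi$, a subset $\Gamma\subseteq\Lambda$ is biclosed in $\Lambda$ if both $\Gamma$ and $\Lambda\setminus\Gamma$ are closed. For $J\subseteq S$, $W_J:=\langle J\rangle$,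 $\Phi_J:=\{\alpha\in\Phi\mid s_\alpha\in W_J\}$, $\Lambda_J:=\Phi_+\cup\Phi_J$, $\mathcal{L}_J$ is the set of all finite biclosed subsets of $\Lambda_J$ ordered by inclusion, and $\tau(\Gamma):=\Gamma\cap\Phi_J$ for $\Gamma\subseteq\Lambda_J$. A complete meet semilattice is a poset in which every non-empty subset has a greatest lower bound. *)

(* Defs.v *)
From HB Require Import structures.
From mathcomp Require Import all_boot all_order all_algebra.
From mathcomp Require Import all_classical all_reals all_analysis.

Set Implicit Arguments.
Unset Strict Implicit.
Unset Printing Implicit Defensive.

Import Order.TTheory GRing.Theory Num.Theory.

Local Open Scope classical_set_scope.
Local Open Scope ring_scope.

(* In a family L of subsets of T ordered by inclusion, [is_meet L Y D] and
   [is_join L Y D] say that D is the greatest lower bound, resp. the least upper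
   bound, of Y within L; D need not be an intersection or a union. *)
Section InclusionOrder.
Variable T : Type.
Implicit Types (L Y : set (set T)) (A B D : set T).

Definition is_meet L Y D :=
  [/\ L D,
      forall A, Y A -> D `<=` A
    & forall B, L B -> (forall A, Y A -> B `<=` A) -> B `<=` D].

Definition is_join L Y D :=
  [/\ L D,
      forall A, Y A -> A `<=` D
    & forall B, L B -> (forall A, Y A -> A `<=` B) -> D `<=` B].

Definition complete_meet_semilattice L :=
  forall Y, Y `<=` L -> Y !=set0 -> exists D, is_meet L Y D.

Definition lattice L :=
  forall A B, L A -> L B ->
    (exists D, is_meet L [set A; B] D) /\ (exists D, is_join L [set A; B] D).

End InclusionOrder.

(* Groups of bijections of T, as sets of functions. The inverse clause does not
   require a member of G to be invertible, so setT is a subgroup and [generated]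
   never ranges over an empty family; if X consists of bijections (here,
   reflections) then [generated X] is the usual subgroup generated by X. *)
Section TransformationGroups.
Variable T : Type.
Implicit Types G X : set (T -> T).

Definition subgroup G :=
  [/\ G id,
      forall f g, G f -> G g -> G (f \o g)
    & forall f g, G f -> cancel f g -> cancel g f -> G g].

Definition generated X : set (T -> T) := smallest subgroup X.

End TransformationGroups.

Section RootSystems.
Variables (R : realType) (V : lmodType R).
Variables (B : {symmetric V}) (Pi : set V).
Implicit Types (Gamma Lambda : set V) (J : set (V -> V)).

Definition positively_independent :=
  forall (s : seq V) (c : V -> R),
    uniq s -> (forall a, a \in s -> Pi a) -> (forall a, a \in s -> 0 <= c a) ->
    \sum_(a <- s) c a *: a = 0 -> forall a, a \in s -> c a = 0.

Definition simple_roots :=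
  [/\ positively_independent,
      forall a, Pi a -> B a a = 1
    & forall a b, Pi a -> Pi b -> a <> b ->
        (exists2 m : nat, (2 <= m)%N & B a b = - cos (pi / m%:R))
        \/ B a b <= -1].

Definition reflection (a : V) : V -> V := fun v => v - (2 * B v a) *: a.

Definition simple_reflections : set (V -> V) := reflection @` Pi.

Definition coxeter_group : set (V -> V) := generated simple_reflections.

Definition roots : set V :=
  [set b | exists w a, [/\ coxeter_group w, Pi a & b = w a]].

Definition nonneg_combinations : set V :=
  [set v | exists (s : seq V) (c : V -> R),
     [/\ forall a, a \in s -> Pi a, forall a, a \in s -> 0 <= c a
       & v = \sum_(a <- s) c a *: a]].

Definition positive_roots : set V := roots `&` nonneg_combinations.

Definition closed_roots Gamma :=
  Gamma `<=` roots /\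
  forall a b, Gamma a -> Gamma b -> forall x y : R, 0 <= x -> 0 <= y ->
    roots (x *: a + y *: b) -> Gamma (x *: a + y *: b).

Definition root_closure Gamma : set V := smallest closed_roots Gamma.

(* Meant for Lambda closed. *)
Definition biclosed_in Lambda Gamma :=
  [/\ Gamma `<=` Lambda, closed_roots Gamma & closed_roots (Lambda `\` Gamma)].

Definition finite_biclosed Lambda : set (set V) :=
  [set Gamma | finite_set Gamma /\ biclosed_in Lambda Gamma].

(* \Phi_J and \Lambda_J; J is a set of simple reflections, not of simple roots. *)
Definition roots_of J : set V :=
  [set a | roots a /\ generated J (reflection a)].

Definition Lambda_of J : set V := positive_roots `|` roots_of J.

Definition calL J : set (set V) := finite_biclosed (Lambda_of J).

Definition tau J Gamma : set V := Gamma `&` roots_of J.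

End RootSystems.

(* Main.v *)
Require Import Defs.
From HB Require Import structures.
From mathcomp Require Import all_boot all_order all_algebra.
From mathcomp Require Import all_classical all_reals all_analysis.
From mathcomp Require Import ring lra zify.

Set Implicit Arguments.
Unset Strict Implicit.
Unset Printing Implicit Defensive.

Import Order.TTheory GRing.Theory Num.Theory.

Local Open Scope classical_set_scope.
Local Open Scope card_scope.
Local Open Scope ring_scope.

(** Write [E] for the set of positive roots and call the images of [E] under
    the group chambers. Every chamber is a closed set of roots containing
    exactly one of each pair of opposite roots, and conversely such a set is
    a chamber as soon as it misses finitely many roots of [E]
    ([psys_chamber]): it misses a simple root, since otherwise a lowest
    positive root that it misses would be the sum of a lower one and of a
    multiple of a simple root; and crossing the wall of that simple root
    makes the difference smaller. Hence the finite biclosed subsets of [E]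
    are the sets E \ C for chambers [C].

    Joins of such sets ([join_interval]) are found by induction on an
    interval between two chambers. If the two sets contain a common simple
    root, cross its wall. Otherwise they contain different simple roots,
    which span a dihedral subsystem inside the upper bound, finite because
    the bound is. The first case applies to one of the sets and the chamber
    beyond all the walls of that subsystem, and then to their join and the
    other set. Exchanging the two ends of the interval gives bounded meets
    ([meet_interval]), and a gallery from one chamber to the other, along
    which no root outside both is met, gives arbitrary meets
    ([meet_chamber]).

    Now let [a] be the simple root whose reflection lies in [J], so that
    Lambda is the union of [E] and of its neighbour across the wall of [a].
    The finite biclosed subsets of Lambda are the complements in it of three
    sorts of sets ([fbP]): chambers, unions of two chambers adjacent along
    the wall of [a], and intersections of two such chambers. The four
    possible traces on {a, -a} are thus: {a} and {-a} for chambers on either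
    side, the empty set for unions and {a, -a} for intersections.

    A join avoiding [- a], or [a], is a join of chambers seen from one side
    of the wall; if both are avoided the two views agree and show a wall of
    the required sort ([fb_join_half]). When both [a] and [- a] occur, they
    are first added to each of the two sets. That the result is biclosed is
    the main point ([fb_add_wall]): it says that if a chamber [G] lies below
    a chamber having the wall of [a], then so has the join of [G] with the
    reflection of [E] ([wall_join]), which is proved by moving the base
    around the codimension two faces of the wall. The added roots can then
    be removed from all the sets without changing the problem.

    Meets below a set containing [a] and [- a] are joins from the opposite
    end. The remaining meets reduce to meets of chambers, except when the
    answer contains neither [a] nor [- a]; there one starts from a point
    where a gallery between the two sets crosses the wall of [a], and
    descends by bounded meets ([fb_meet_split]).

    Finally, every subset of {a, -a} is biclosed in it, and each of the two
    chambers that make up Lambda is closed, so that no closure creates [a]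
    or [- a]: this makes the restriction to {a, -a} compatible with
    everything. *)

(** * Linear identities in a module *)

(** A reflexive normalizer: an identity between linear combinations holds as
    soon as the coefficients of every atom agree, which is a ring problem. *)
Inductive lincomb (R : Type) :=
  | LAtom of nat
  | LZero
  | LAdd of lincomb R & lincomb R
  | LOpp of lincomb R
  | LScale of R & lincomb R.
Arguments LAtom {R}.
Arguments LZero {R}.

Fixpoint lc_eval (R : comPzRingType) (V : lmodType R) (env : seq V)
    (e : lincomb R) : V :=
  match e with
  | LAtom n => env`_n
  | LZero => 0
  | LAdd e1 e2 => lc_eval env e1 + lc_eval env e2
  | LOpp e1 => - lc_eval env e1
  | LScale a e1 => a *: lc_eval env e1
  end.

Fixpoint lc_coef (R : comPzRingType) (e : lincomb R) (i : nat) : R :=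
  match e with
  | LAtom n => if n == i then 1 else 0
  | LZero => 0
  | LAdd e1 e2 => lc_coef e1 i + lc_coef e2 i
  | LOpp e1 => - lc_coef e1 i
  | LScale a e1 => a * lc_coef e1 i
  end.

Lemma lc_evalE (R : comPzRingType) (V : lmodType R) (env : seq V) e :
  lc_eval env e = \sum_(i < size env) lc_coef e i *: env`_i.
Proof.
elim: e => [n||e1 IH1 e2 IH2|e1 IH1|a e1 IH1] /=.
- case: (ltnP n (size env)) => hn; last first.
    rewrite nth_default// big1 // => i _;
    by rewrite gtn_eqF ?scale0r// (leq_trans (ltn_ord i)).
  rewrite (bigD1 (Ordinal hn)) //= eqxx scale1r big1 ?addr0// => i.
  by rewrite -val_eqE /= eq_sym => /negbTE ->; rewrite scale0r.
- by rewrite big1 // => i _; rewrite scale0r.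
- by rewrite IH1 IH2 -big_split; apply: eq_bigr => i _; rewrite scalerDl.
- by rewrite IH1 -sumrN; apply: eq_bigr => i _; rewrite scaleNr.
- by rewrite IH1 scaler_sumr; apply: eq_bigr => i _; rewrite scalerA.
Qed.

Fixpoint lc_eqn (R : comPzRingType) (e1 e2 : lincomb R) n : Prop :=
  if n is n'.+1 then lc_eqn e1 e2 n' /\ lc_coef e1 n' = lc_coef e2 n'
  else True.

Lemma lc_eq (R : comPzRingType) (V : lmodType R) (env : seq V) e1 e2 :
  lc_eqn e1 e2 (size env) -> lc_eval env e1 = lc_eval env e2.
Proof.
move=> h; rewrite !lc_evalE; apply: eq_bigr => i _; congr (_ *: _).
elim: (size env) (nat_of_ord i) (ltn_ord i) h => [//|n IH] j.
by rewrite ltnS leq_eqVlt => /orP[/eqP-> []//|jn [h _]]; apply: IH.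
Qed.

Ltac lc_add_atom env x :=
  lazymatch env with
  | nil => constr:([:: x])
  | x :: ?r => env
  | ?y :: ?r => let r' := lc_add_atom r x in constr:(y :: r')
  end.
Ltac lc_atoms env t :=
  lazymatch t with
  | (?a *: ?x)%R => lc_atoms env x
  | (?x + ?y)%R => let e := lc_atoms env x in lc_atoms e y
  | (- ?x)%R => lc_atoms env x
  | 0%R => env
  | ?x => lc_add_atom env x
  end.
Ltac lc_index env x :=
  lazymatch env with
  | x :: _ => constr:(0%N)
  | _ :: ?r => let n := lc_index r x in constr:(S n)
  end.
Ltac lc_reify R env t :=
  lazymatch t with
  | (?a *: ?x)%R => let e := lc_reify R env x in constr:(@LScale R a e)
  | (?x + ?y)%R =>
    let e1 := lc_reify R env x in let e2 := lc_reify R env y in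
    constr:(@LAdd R e1 e2)
  | (- ?x)%R => let e := lc_reify R env x in constr:(@LOpp R e)
  | 0%R => constr:(@LZero R)
  | ?x => let n := lc_index env x in constr:(@LAtom R n)
  end.
Ltac lincomb :=
  lazymatch goal with
  | |- @eq ?T ?t1 ?t2 =>
    let R := lazymatch goal with V : GRing.Lmodule.type ?R |- _ => R end in
    let env0 := lc_atoms (@nil T) t1 in
    let env := lc_atoms env0 t2 in
    let e1 := lc_reify R env t1 in
    let e2 := lc_reify R env t2 in
    apply: (@lc_eq _ _ env e1 e2); rewrite /=; repeat split; ring
  end.

(** * Reflections and words *)

Section Words.
Variables (R : realType) (V : lmodType R) (B : {symmetric V}).
Implicit Types (a u v : V) (w : seq V).
Local Notation s := (reflection B).

Lemma form_linl x u v u' : B (x *: u + v) u' = x * B u u' + B v u'.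
Proof. by rewrite linearDl linearZl_LR. Qed.

Lemma form_linr x u v u' : B u' (x *: u + v) = x * B u' u + B u' v.
Proof. by rewrite linearDr linearZr. Qed.

Lemma form_sym u v : B u v = B v u.
Proof. by rewrite hermC mul1r. Qed.

Lemma form_scalel x u v : B (x *: u) v = x * B u v.
Proof. by rewrite linearZl_LR. Qed.

Lemma form_suml (I : Type) (r : seq I) (F : I -> V) v :
  B (\sum_(i <- r) F i) v = \sum_(i <- r) B (F i) v.
Proof. by rewrite linear_sumlz. Qed.

Lemma form_oppl u v : B (- u) v = - B u v.
Proof. by rewrite linearNl. Qed.

Lemma reflection_lin a x u v : s a (x *: u + v) = x *: s a u + s a v.
Proof. rewrite /reflection form_linl; lincomb. Qed.

Lemma reflection_self a : B a a = 1 -> s a a = - a.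
Proof. by rewrite /reflection => ->; lincomb. Qed.

Lemma reflectionE a v : s a v = (- (2 * B v a)) *: a + v.
Proof. by rewrite /reflection; lincomb. Qed.

Lemma reflectionK a : B a a = 1 -> involutive (s a).
Proof.
move=> aa v; rewrite (reflectionE a v) reflection_lin reflection_self // /reflection; lincomb.
Qed.

Lemma reflection_form a u v : B a a = 1 -> B (s a u) (s a v) = B u v.
Proof.
move=> aa; rewrite !reflectionE form_linl !form_linr aa (form_sym a v); ring.
Qed.

Definition wact w v := foldr s v w.

Lemma wact_cat w1 w2 v : wact (w1 ++ w2) v = wact w1 (wact w2 v).
Proof. by rewrite /wact foldr_cat. Qed.

Lemma wact_rcons w a v : wact (rcons w a) v = wact w (s a v).
Proof. by rewrite -cats1 wact_cat. Qed.

Lemma wact_lin w x u v : wact w (x *: u + v) = x *: wact w u + wact w v.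
Proof. by elim: w => //= a w ->; rewrite reflection_lin. Qed.

Lemma wact0 w : wact w 0 = 0.
Proof. by have := wact_lin w (-1) 0 0; rewrite scaler0 addr0 scaleN1r addNr. Qed.

Lemma wactZ w x u : wact w (x *: u) = x *: wact w u.
Proof. by have := wact_lin w x u 0; rewrite !addr0 wact0 addr0. Qed.

Lemma wactD w u v : wact w (u + v) = wact w u + wact w v.
Proof. by have := wact_lin w 1 u v; rewrite !scale1r. Qed.

Lemma wactN w u : wact w (- u) = - wact w u.
Proof. by rewrite -scaleN1r wactZ scaleN1r. Qed.

Definition unit_word w := forall a, a \in w -> B a a = 1.

Lemma wactK w : unit_word w -> cancel (wact w) (wact (rev w)).
Proof.
elim: w => //= a w IH ha v; rewrite rev_cons wact_rcons reflectionK.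
  by rewrite IH // => b bw; rewrite ha // inE bw orbT.
by rewrite ha // mem_head.
Qed.

Lemma wactVK w : unit_word w -> cancel (wact (rev w)) (wact w).
Proof.
move=> ha; have := @wactK (rev w); rewrite revK; apply.
by move=> a; rewrite mem_rev; apply: ha.
Qed.

Lemma wact_form w u v : unit_word w -> B (wact w u) (wact w v) = B u v.
Proof.
elim: w => //= a w IH ha; rewrite reflection_form ?IH // ?ha ?mem_head //.
by move=> b bw; rewrite ha // inE bw orbT.
Qed.

End Words.

(** * Cones *)

Section Cones.
Variables (R : realType) (V : lmodType R).
Implicit Types (P Q : set V) (x y z : V).

(** Weights are attached to list entries rather than to vectors, so that sums
    of cone elements are concatenations. *)
Definition cone P : set V :=
  [set v | exists2 l : seq (R * V), (forall p, p \in l -> 0 <= p.1 /\ P p.2)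
     & v = \sum_(p <- l) p.1 *: p.2].

Lemma cone0 P : cone P 0.
Proof. by exists [::] => //; rewrite big_nil. Qed.

Lemma coneD P x y : cone P x -> cone P y -> cone P (x + y).
Proof.
move=> [l hl ->] [m hm ->]; exists (l ++ m); last by rewrite big_cat.
by move=> p; rewrite mem_cat => /orP[/hl|/hm].
Qed.

Lemma coneZ P t x : 0 <= t -> cone P x -> cone P (t *: x).
Proof.
move=> t0 [l hl ->]; exists [seq (t * p.1, p.2) | p <- l].
  by move=> _ /mapP[p /hl[p0 Pp] ->] /=; rewrite mulr_ge0.
by rewrite big_map scaler_sumr; apply: eq_bigr => p _; rewrite scalerA.
Qed.

Lemma cone_gen P x : P x -> cone P x.
Proof.
move=> Px; exists [:: (1, x)]; last by rewrite big_seq1 scale1r.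
by move=> p; rewrite inE => /eqP -> /=; rewrite ler01.
Qed.

Lemma cone_lin P t u x y : 0 <= t -> 0 <= u -> cone P x -> cone P y ->
  cone P (t *: x + u *: y).
Proof. by move=> t0 u0 Px Py; apply: coneD; apply: coneZ. Qed.

Lemma sub_cone P Q x : P `<=` Q -> cone P x -> cone Q x.
Proof. by move=> PQ [l hl ->]; exists l => // p /hl[? /PQ]. Qed.

(** Against a simple root [a], only the part [y] has a pairing of known sign. *)
Lemma cone_split P a x : P a -> cone P x ->
  exists2 c : R, 0 <= c & exists2 y, cone (P `\ a) y & x = c *: a + y.
Proof.
move=> Pa [l hl ->]; elim: l hl => [|[t b] l IH] hl.
  exists 0 => //; exists 0; first exact: cone0.
  by rewrite big_nil scale0r addr0.
have [p pl|c c0 [y hy e]] := IH; first by apply: hl; rewrite inE pl orbT.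
have /= [t0 Pb] := hl _ (mem_head _ _).
rewrite big_cons e /=; have [->|ba] := eqVneq b a.
  by exists (t + c); [rewrite addr_ge0|exists y => //; lincomb].
exists c => //; exists (t *: b + y); last by lincomb.
by apply: coneD => //; apply: coneZ => //; apply: cone_gen; split=> //; apply/eqP.
Qed.

End Cones.

(** * Dihedral subgroups *)

Section Dihedral.
Variables (R : realType) (V : lmodType R) (B : {symmetric V}).
Local Notation s := (reflection B).

(** The Chebyshev polynomials of the second kind, shifted by one, at [c]: the
    coordinates of the roots of a rank two root system. *)
Fixpoint cheb (c : R) n :=
  if n is n1.+1 then
    if n1 is n2.+1 then 2 * c * cheb c n1 - cheb c n2 else 1
  else 0.

Lemma chebSS c n : cheb c n.+2 = 2 * c * cheb c n.+1 - cheb c n.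
Proof. by []. Qed.

(** Two mirrors whose roots have product at most -1 generate an infinite group:
    the coordinates of the roots grow. *)
Lemma cheb_incr c n : 1 <= c -> 0 <= cheb c n /\ cheb c n <= cheb c n.+1.
Proof.
move=> c1; elim: n => [|n [p0 pS]]; first by rewrite /= ler01.
split; first exact: le_trans p0 pS.
by rewrite chebSS; nra.
Qed.

Lemma cheb_cos t n : cheb (cos t) n * sin t = sin (n%:R * t).
Proof.
suff: cheb (cos t) n * sin t = sin (n%:R * t)
   /\ cheb (cos t) n.+1 * sin t = sin (n.+1%:R * t) by case.
elim: n => [|n [h0 h1]]; first by rewrite /= !mul0r sin0 !mul1r.
split=> //; rewrite chebSS mulrBl h0 -(mulrA (2 * cos t)) h1.
have -> : n.+2%:R * t = n.+1%:R * t + t by rewrite -(natr1 n.+1); ring.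
have -> : n%:R * t = n.+1%:R * t - t by rewrite -(natr1 n); ring.
by rewrite sinB sinD; ring.
Qed.

(** Built on the left, so that [a] stays the rightmost letter, the first to act. *)
Fixpoint alt (a b : V) n :=
  if n is n'.+1 then (if odd n' then b else a) :: alt a b n' else [::].

Lemma size_alt a b n : size (alt a b n) = n.
Proof. by elim: n => //= n ->. Qed.

Lemma alt_rcons a b n : alt a b n.+1 = rcons (alt b a n) a.
Proof. by elim: n => // n IH; rewrite /= -IH /=; case: odd. Qed.

Definition letters (a b : V) (d : seq V) := forall x, x \in d -> x = a \/ x = b.

Lemma letters_alt a b n : letters a b (alt a b n).
Proof.
elim: n => //= n IH x; rewrite inE => /orP[/eqP->|/IH//].
by case: odd; [right|left].
Qed.

Lemma lettersC a b d : letters a b d -> letters b a d.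
Proof. by move=> h x /h[]; [right|left]. Qed.

Lemma alt_suffix a b k j : exists2 d, letters a b d &
  size d = k /\ alt a b (k + j) = d ++ alt a b j.
Proof.
elim: k => [|k [d ld [sd e]]]; first by exists [::].
exists ((if odd (k + j) then b else a) :: d); last by rewrite /= e sd.
by move=> x; rewrite inE => /orP[/eqP->|/ld//]; case: odd; [right|left].
Qed.

Variables (a b : V).
Hypotheses (aa : B a a = 1) (bb : B b b = 1).

(** Each letter reflects the last root reached in the mirror which did not produce
    it, whence the recursion of the Chebyshev polynomials. *)
Lemma alt_act n : let c := - B a b in
  wact B (alt b a n) a = cheb c n.+1 *: (if odd n then b else a)
                       + cheb c n *: (if odd n then a else b).
Proof.
move=> c; elim: n => [|n IH]; first by rewrite /=; lincomb.
rewrite [alt _ _ _]/= [wact _ _ _]/= -/(wact B (alt b a n) a) IH chebSS.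
have eab : s a b = 2 * c *: a + b by rewrite reflectionE (form_sym B b) /c; lincomb.
have eba : s b a = 2 * c *: b + a by rewrite reflectionE /c; lincomb.
rewrite [odd n.+1]/=; case: (odd n); rewrite /= reflection_lin.
  have -> : cheb c n *: a = cheb c n *: a + 0 by rewrite addr0.
  rewrite eab reflection_lin reflection_self //.
  have -> : s a 0 = 0 by rewrite reflectionE linear0l; lincomb.
  by lincomb.
have -> : cheb c n *: b = cheb c n *: b + 0 by rewrite addr0.
rewrite eba reflection_lin reflection_self //.
have -> : s b 0 = 0 by rewrite reflectionE linear0l; lincomb.
by lincomb.
Qed.

(** Equal adjacent letters cancel. *)
Lemma letters_reduce d : letters a b d -> exists n x y,
  [/\ (x, y) = (a, b) \/ (x, y) = (b, a), (n <= size d)%N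
    & wact B d =1 wact B (alt x y n)].
Proof.
elim: d => [|e d IH] ld; first by exists 0%N, a, b; split=> //; left.
have [x xd|n [x [y [xy nd dE]]]] := IH; first by apply: ld; rewrite inE xd orbT.
have exy : e = x \/ e = y.
  by have := ld e (mem_head _ _); case: xy => -[-> ->] // []; [right|left].
have ee : B e e = 1 by case: (ld e (mem_head _ _)) => ->.
have hd v : wact B (e :: d) v = s e (wact B (alt x y n) v) by rewrite /= -dE.
have cons_case : e = (if odd n then y else x) -> exists n x y,
    [/\ (x, y) = (a, b) \/ (x, y) = (b, a), (n <= (size d).+1)%N
      & wact B (e :: d) =1 wact B (alt x y n)].
  by move=> he; exists n.+1, x, y; split=> // v; rewrite hd /= -he.
have [he|he] := pselect (e = if odd n then y else x); first exact: cons_case.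
case: n nd dE hd he {cons_case} => [|n] nd dE hd he.
  exists 1%N, e, (if e == a then b else a); split=> //.
  case: (ld e (mem_head _ _)) => ->; first by left; rewrite eqxx.
  by right; case: eqP => // ->.
exists n, x, y; split=> //; first by rewrite /= leqW // ltnW.
have he' : e = if odd n then y else x.
  by move: he => /=; case: (odd n); case: exy => ->.
by move=> v; rewrite hd /= -he' reflectionK.
Qed.

End Dihedral.

Section DihedralOrder.
Variables (R : realType) (V : lmodType R) (B : {symmetric V}).
Variables (a b : V).
Hypotheses (aa : B a a = 1) (bb : B b b = 1).
Local Notation s := (reflection B).
Variable (m : nat).
Hypothesis (m2 : (2 <= m)%N).
Hypothesis (ab : B a b = - cos (pi / m%:R)).
Local Notation c := (cos (pi / m%:R) : R).

Lemma angle_bounds : 0 < pi / m%:R :> R /\ pi / m%:R <= pi / 2 :> R.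
Proof.
have m0 : 0 < m%:R :> R by rewrite ltr0n; case: m m2.
split; first by rewrite divr_gt0 // pi_gt0.
have m2R : 2 <= m%:R :> R by rewrite (ler_nat _ 2).
by rewrite ler_pM2l ?pi_gt0 // lef_pV2 ?posrE.
Qed.

Lemma sin_angle_gt0 : 0 < sin (pi / m%:R) :> R.
Proof.
have [h0 h1] := angle_bounds; apply: sin_gt0_pi; rewrite h0 /=.
by have := pi_gt0 R; lra.
Qed.

Lemma cheb_ge0 n : (n <= m)%N -> 0 <= cheb c n.
Proof.
move=> nm; rewrite -(pmulr_lge0 _ sin_angle_gt0) cheb_cos.
have m0 : 0 < m%:R :> R by rewrite ltr0n; case: m m2.
apply: sin_ge0_pi; rewrite mulr_ge0 ?ler0n ?(ltW (proj1 angle_bounds)) //=.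
by rewrite mulrA ler_pdivrMr // mulrC ler_pM2l ?pi_gt0 // ler_nat.
Qed.

Lemma cheb_period k : (k <= 1)%N ->
  cheb c (2 * m + k) = k%:R /\ cheb c (2 * m - k) = - k%:R.
Proof.
move=> k1; have m0 : m%:R != 0 :> R by rewrite pnatr_eq0; case: m m2.
have km : (k <= 2 * m)%N by rewrite (leq_trans k1) // muln_gt0; case: m m2.
have s0 := lt0r_neq0 sin_angle_gt0.
have ek : k%:R * sin (pi / m%:R) = sin (k%:R * (pi / m%:R)) :> R.
  by case: k k1 {km} => [|[|]] // _; rewrite ?mul0r ?sin0 ?mul1r.
split; apply: (mulIf s0); rewrite cheb_cos ?mulNr ek.
  rewrite natrD natrM mulrDl (_ : 2 * m%:R * (pi / m%:R) = pi + pi).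
    by rewrite addrAC sinDpi addrC sinDpi opprK.
  by field.
rewrite natrB // natrM mulrBl (_ : 2 * m%:R * (pi / m%:R) = pi + pi).
  by rewrite addrAC sinDpi addrC sinDpi opprK sinN.
by field.
Qed.

Lemma wact_orth d v : letters a b d -> B v a = 0 -> B v b = 0 -> wact B d v = v.
Proof.
move=> ld va vb; elim: d ld => //= e d IH ld.
rewrite IH => [|x xd]; last by apply: ld; rewrite inE xd orbT.
rewrite reflectionE; have -> : B v e = 0 by case: (ld e (mem_head _ _)) => ->.
by lincomb.
Qed.

(** The rotation by twice the angle of the two mirrors has order dividing [m]:
    it fixes both roots, and everything orthogonal to their plane. *)
Lemma alt_order v : wact B (alt a b (2 * m)) v = v.
Proof.
have m0 : (0 < m)%N by case: m m2.
have ba : B b a = - c by rewrite form_sym.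
have odd2m : odd (2 * m) = false by rewrite oddM.
have [_] := cheb_period (leq0n 1); rewrite subn0 oppr0 => c2m.
have [c2mS c2mP] := cheb_period (leqnn 1).
have e2m : (2 * m = (2 * m - 1).+1)%N by rewrite subn1 prednK // muln_gt0.
have fa : wact B (alt a b (2 * m)) a = a.
  rewrite e2m alt_rcons wact_rcons reflection_self // wactN alt_act // ab opprK.
  rewrite -e2m c2m c2mP.
  have -> : odd (2 * m - 1) by have := odd2m; rewrite {1}e2m /= => /negbFE.
  by lincomb.
have fb : wact B (alt a b (2 * m)) b = b.
  rewrite alt_act // ba opprK -addn1 c2mS odd2m.
  by rewrite c2m; lincomb.
pose D := sin (pi / m%:R) ^+ 2 : R.
have D0 : D != 0 by rewrite expf_neq0 // lt0r_neq0 // sin_angle_gt0.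
have DE : D = 1 - c ^+ 2 by have := cos2Dsin2 (pi / m%:R : R); rewrite /D; lra.
clearbody D.
pose x := (B v a + c * B v b) / D; pose y := (B v b + c * B v a) / D.
pose v0 := v - (x *: a + y *: b).
have vE : v = 1 *: v0 + (x *: a + (y *: b + 0)) by rewrite /v0; lincomb.
have v0E w : B v0 w = B v w - x * B a w - y * B b w.
  rewrite (_ : v0 = (- x) *: a + ((- y) *: b + v)); last by rewrite /v0; lincomb.
  by rewrite !form_linl; ring.
have v0a : B v0 a = 0.
  rewrite v0E aa ba /x /y; transitivity (B v a * (D - (1 - c ^+ 2)) / D).
    by field.
  by rewrite -DE subrr mulr0 mul0r.
have v0b : B v0 b = 0.
  rewrite v0E bb ab /x /y; transitivity (B v b * (D - (1 - c ^+ 2)) / D).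
    by field.
  by rewrite -DE subrr mulr0 mul0r.
rewrite {1}vE !wact_lin fa fb wact0 (wact_orth _ v0a v0b) -?vE //.
exact: letters_alt.
Qed.

(** Beyond length [m] an alternating word can be shortened after one more
    letter, by going around the dihedral relation the other way. *)
Lemma alt_shorten n : (m <= n)%N -> exists2 d, letters a b d &
  (size d < n)%N /\ forall v, wact B d v = wact B (alt b a n) (s a v).
Proof.
move=> mn; have m0 : (0 < m)%N by case: m m2.
have ub d : letters a b d -> unit_word B d by move=> ld e /ld[]->.
have [d1 ld1 [sd1 e1]] := alt_suffix a b (n - m) m.+1.
have [d2 ld2 [sd2 e2]] := alt_suffix a b m.-1 m.+1.
exists (d1 ++ rev d2).
  by move=> e; rewrite mem_cat mem_rev => /orP[/ld1|/ld2].
split; first by rewrite size_cat size_rev sd1 sd2; lia.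
move=> v; rewrite -wact_rcons -alt_rcons.
have -> : (n.+1 = n - m + m.+1)%N by lia.
rewrite e1 !wact_cat; congr (wact B d1 _).
have := alt_order v; have -> : (2 * m = m.-1 + m.+1)%N by lia.
by rewrite e2 wact_cat => h; rewrite -{1}h wactK //; apply: ub.
Qed.

End DihedralOrder.

Section Dichotomy.
Variables (R : realType) (V : lmodType R) (B : {symmetric V}) (Pi : set V).
Hypothesis hPi : simple_roots B Pi.
Local Notation s := (reflection B).
Local Notation act := (wact B).

Definition word (w : seq V) := forall a, a \in w -> Pi a.

Lemma simple_norm a : Pi a -> B a a = 1.
Proof. by case: hPi => _ h _; apply: h. Qed.

Lemma word_unit w : word w -> unit_word B w.
Proof. by move=> hw a /hw /simple_norm. Qed.

Lemma word_cons a w : Pi a -> word w -> word (a :: w).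
Proof. by move=> ha hw b; rewrite inE => /orP[/eqP->|/hw]. Qed.

Lemma word_cat w1 w2 : word w1 -> word w2 -> word (w1 ++ w2).
Proof. by move=> h1 h2 b; rewrite mem_cat => /orP[/h1|/h2]. Qed.

Lemma word_rev w : word w -> word (rev w).
Proof. by move=> h b; rewrite mem_rev => /h. Qed.

Lemma letters_word a b d : Pi a -> Pi b -> letters a b d -> word d.
Proof. by move=> Pa Pb ld e /ld[]->. Qed.

(** An alternating word ending in [a] loses that letter. Otherwise the image of [a] has
    Chebyshev coordinates: they are nonnegative as long as the word is shorter than
    the order of the rotation, and a longer word is shortened by [alt_shorten]. *)
Lemma dihedral_dichotomy a b d : Pi a -> Pi b -> a <> b -> letters a b d ->
  (exists p q, [/\ 0 <= p, 0 <= q & act d a = p *: a + q *: b]) \/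
  exists2 d', letters a b d' &
    (size d' < size d)%N /\ forall v, act d' v = act d (s a v).
Proof.
move=> Pa Pb nab ld; have aa := simple_norm Pa; have bb := simple_norm Pb.
have [n [x [y [xy nd dE]]]] := letters_reduce aa bb ld.
case: xy => -[? ?]; subst x y.
  case: n nd dE => [|n] nd dE.
    by left; exists 1, 0; rewrite ler01; split=> //; rewrite dE /=; lincomb.
  right; exists (alt b a n); first exact/lettersC/letters_alt.
  split; first by rewrite size_alt.
  by move=> v; rewrite dE alt_rcons wact_rcons reflectionK.
set c := - B a b.
have pos : 0 <= cheb c n.+1 -> 0 <= cheb c n ->
    exists p q, [/\ 0 <= p, 0 <= q & act d a = p *: a + q *: b].
  move=> p1 p0; rewrite dE alt_act // -/c; case: odd.
    by exists (cheb c n), (cheb c n.+1); split=> //; lincomb.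
  by exists (cheb c n.+1), (cheb c n); split.
have [|[m m2 ab]|ab] := (let: And3 _ _ h := hPi in h) a b Pa Pb => //; last first.
  have c1 : 1 <= c by rewrite /c; lra.
  by left; apply: pos; [case: (cheb_incr n.+1 c1)|case: (cheb_incr n c1)].
have cE : c = cos (pi / m%:R) by rewrite /c ab opprK.
have [mn|nm] := leqP m n; last first.
  by left; apply: pos; rewrite cE cheb_ge0 // ltnW.
right; have [d' ld' [sd' d'E]] := alt_shorten aa bb m2 ab mn.
by exists d' => //; split=> [|v]; rewrite ?d'E ?dE // (leq_trans sd').
Qed.

(** The sign of roots comes from this dichotomy. Write the word as [v] times a word
    in [a] and another letter, with [v] as short as possible; then [v] has no
    descent along either letter, and the dihedral case decides. *)
Lemma exchange w a : word w -> Pi a -> cone Pi (act w a) \/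
  exists2 w', word w' & (size w' < size w)%N /\
                        forall v, act w' v = act w (s a v).
Proof.
have [n] := ubnP (size w); elim: n w a => // n IHn w a; rewrite ltnS => sw hw Pa.
case/lastP: w sw hw => [|w1 b] sw hw; first by left; apply: cone_gen.
have Pb : Pi b by apply: hw; rewrite mem_rcons mem_head.
have hw1 : word w1 by move=> x xw; apply: hw; rewrite mem_rcons inE xw orbT.
have aa := simple_norm Pa; have bb := simple_norm Pb.
have [eab|nab] := pselect (a = b).
  subst b; right; exists w1 => //; split; first by rewrite size_rcons.
  by move=> v; rewrite wact_rcons reflectionK.
have lb : letters a b [:: b] by move=> x; rewrite inE => /eqP; right.
have : forall v, act (rcons w1 b) v = act w1 (act [:: b] v).
  by move=> v; rewrite wact_rcons.
have : (size w1 + size [:: b] <= size (rcons w1 b))%N by rewrite size_rcons addn1.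
move: [:: b] lb => d; have : (size w1 < size (rcons w1 b))%N by rewrite size_rcons.
move: (rcons w1 b) sw hw => w sw hw.
have [k] := ubnP (size w1); elim: k w1 hw1 d => // k IHk w1 hw1 d.
rewrite ltnS => sk s1 ld sd wE.
have descend e w2 : (e = a) \/ (e = b) -> word w2 -> (size w2 < size w1)%N ->
    (forall v, act w2 v = act w1 (s e v)) -> cone Pi (act w a) \/
    exists2 w', word w' & (size w' < size w)%N /\
                          forall v, act w' v = act w (s a v).
  move=> he hw2 s2 w2E; apply: (IHk w2 hw2 (e :: d)).
  - exact: leq_trans s2 sk.
  - exact: ltn_trans s2 s1.
  - by move=> x; rewrite inE => /orP[/eqP->|/ld].
  - by rewrite /= addnS; apply: leq_trans sd; rewrite ltn_add2r.
  - by move=> v; rewrite wE w2E /= reflectionK //; case: he => ->.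
have sn : (size w1 < n)%N by apply: leq_trans s1 sw.
have [ca|[w2 hw2 [s2 w2E]]] := IHn w1 a sn hw1 Pa; last by apply: (descend a w2); auto.
have [cb|[w2 hw2 [s2 w2E]]] := IHn w1 b sn hw1 Pb; last by apply: (descend b w2); auto.
have [[p [q [p0 q0 e]]]|[d' ld' [sd' d'E]]] := dihedral_dichotomy Pa Pb nab ld.
  by left; rewrite wE e wactD !wactZ; apply: cone_lin.
right; exists (w1 ++ d'); first exact/word_cat/letters_word/ld'.
split; first by rewrite size_cat; apply: leq_trans sd; rewrite ltn_add2l.
by move=> v; rewrite wact_cat d'E wE.
Qed.

(** If the word becomes shorter after [s a], the shorter one sends [a] to the
    opposite root. *)
Lemma act_pos_or_neg w a : word w -> Pi a ->
  cone Pi (act w a) \/ cone Pi (- act w a).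
Proof.
have [n] := ubnP (size w); elim: n w => // n IH w; rewrite ltnS => sw hw Pa.
have [|[w' hw' [sw' w'E]]] := exchange hw Pa; first by left.
have e : act w' a = - act w a.
  by rewrite w'E reflection_self ?wactN //; apply: simple_norm.
have [|] := IH w' (leq_trans sw' sw) hw' Pa; rewrite e; first by right.
by rewrite opprK; left.
Qed.

End Dichotomy.

(** * Extremal elements of finite sets *)

Section FiniteSets.
Variable T : choiceType.
Implicit Types A : set T.

Lemma finite_subset_ind (P : set T -> Prop) :
  (forall A, finite_set A -> (forall A', A' `<` A -> P A') -> P A) ->
  forall A, finite_set A -> P A.
Proof.
move=> IH A fA; have [n] := ubnP (size (finmap.enum_fset (fset_set A))).
elim: n A fA => // n IHn A fA; rewrite ltnS => sA.
apply: IH => // A' [A'A nAA']; have fA' := sub_finite_set A'A fA.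
apply: IHn => //; apply: leq_trans sA; apply: finmap.fproper_ltn_card.
apply/andP; split; first by rewrite -fset_set_sub.
by apply/negP; rewrite -fset_set_sub.
Qed.

Lemma finite_minimal (r : T -> T -> Prop) A :
  (forall x y z, r x y -> r y z -> r x z) -> (forall x, ~ r x x) ->
  finite_set A -> A !=set0 -> exists2 x, A x & forall y, A y -> ~ r y x.
Proof.
move=> rtr rirr; move: A; apply: finite_subset_ind => A fA IH [x Ax].
have [[y [Ay yx]]|nx] := pselect (exists y, A y /\ r y x); last first.
  by exists x => // y Ay yx; apply: nx; exists y.
have [||z [Az zx] zmin] := IH (A `&` [set z | r z x]).
- by split=> [z []//|h]; have [_ /rirr] := h x Ax.
- by exists y.
exists z => // u Au uz; apply: (zmin u) => //; split=> //.
exact: rtr uz zx.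
Qed.

End FiniteSets.

(** * Positive roots *)

Section Roots.
Variables (R : realType) (V : lmodType R) (B : {symmetric V}) (Pi : set V).
Hypothesis hPi : simple_roots B Pi.
Local Notation s := (reflection B).
Local Notation act := (wact B).
Local Notation Phi := (Defs.roots B Pi).
Local Notation Pos := (positive_roots B Pi).

Lemma coxeter_word f : coxeter_group B Pi f <-> exists2 w, word Pi w & f = act w.
Proof.
split=> [hf|[w hw ->]]; last first.
  move=> G [[Gid Gcomp _] GS]; elim: w hw => //= a w IH hw.
  have := Gcomp (s a) (act w); apply.
    by apply: GS; exists a => //; apply: hw; exact: mem_head.
  by apply: IH => b bw; apply: hw; rewrite inE bw orbT.
move: f hf; apply: (@smallest_sub _ _ _ [set f | exists2 w, word Pi w & f = act w]).
  split; first by exists [::] => //; apply/funext.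
    move=> _ _ [w hw ->] [w' hw' ->]; exists (w ++ w'); first exact: word_cat.
    by apply/funext => v; rewrite wact_cat.
  move=> _ g [w hw ->] _ gK; exists (rev w); first exact: word_rev.
  apply/funext => v; rewrite -[in RHS](gK v) wactK //.
  exact: (word_unit hPi).
move=> _ [a Pa <-]; exists [:: a]; last by apply/funext.
by move=> b; rewrite inE => /eqP->.
Qed.

Lemma rootE b : Phi b <-> exists w a, [/\ word Pi w, Pi a & b = act w a].
Proof.
split=> [[f [a [/coxeter_word[w hw ->] Pa ->]]]|[w [a [hw Pa ->]]]].
  by exists w, a.
by exists (act w), a; split=> //; apply/coxeter_word; exists w.
Qed.

Lemma simple_root a : Pi a -> Phi a.
Proof. by move=> Pa; apply/rootE; exists [::], a. Qed.

Lemma root_norm b : Phi b -> B b b = 1.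
Proof.
move=> /rootE[w [a [hw Pa ->]]]; rewrite wact_form; last exact: (word_unit hPi).
exact: (simple_norm hPi).
Qed.

Lemma root_act w b : word Pi w -> Phi b -> Phi (act w b).
Proof.
move=> hw /rootE[w' [a [hw' Pa ->]]]; apply/rootE; exists (w ++ w'), a.
by rewrite wact_cat; split=> //; exact: word_cat.
Qed.

Lemma root_opp b : Phi b -> Phi (- b).
Proof.
move=> /rootE[w [a [hw Pa ->]]]; apply/rootE; exists (rcons w a), a; split=> //.
  by rewrite -cats1; apply: word_cat => // c; rewrite inE => /eqP->.
by rewrite wact_rcons reflection_self ?wactN //; exact: (simple_norm hPi).
Qed.

Lemma root_oppE b : Phi (- b) -> Phi b.
Proof. by move=> /root_opp; rewrite opprK. Qed.

Lemma root0 : ~ Phi 0.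
Proof. by move=> /root_norm; rewrite linear0l => /esym/eqP; rewrite oner_eq0. Qed.

Lemma root_reflection a b : Pi a -> Phi b -> Phi (s a b).
Proof.
by move=> Pa; apply: (@root_act [:: a]) => c; rewrite inE => /eqP->.
Qed.

Lemma root_scale t b : Phi b -> 0 <= t -> Phi (t *: b) -> t = 1.
Proof.
move=> /root_norm b1 t0 /root_norm; rewrite form_scalel form_sym form_scalel b1.
by move=> h; nra.
Qed.

(** Positive independence speaks of duplicate-free families, cones of arbitrary
    lists. *)
Lemma collect (P : set V) (l : seq (R * V)) :
  (forall p, p \in l -> 0 <= p.1 /\ P p.2) ->
  exists (r : seq V) (c : V -> R),
    [/\ uniq r, (forall a, a \in r -> P a), (forall a, 0 <= c a),
        \sum_(p <- l) p.1 *: p.2 = \sum_(a <- r) c a *: a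
      & forall p, p \in l -> p.2 \in r /\ p.1 <= c p.2].
Proof.
move=> hl; pose c a := \sum_(p <- l | p.2 == a) p.1.
have l0 p : p \in l -> 0 <= p.1 by move=> /hl[].
exists (undup [seq p.2 | p <- l]), c; split=> [|a|a||p pl].
- exact: undup_uniq.
- by rewrite mem_undup => /mapP[p /hl[_ Pp] ->].
- by rewrite /c big_seq_cond sumr_ge0 // => p /andP[/l0].
- under [in RHS]eq_bigr => a _ do rewrite scaler_suml.
  rewrite (exchange_big_dep xpredT) //= big_seq [in RHS]big_seq.
  apply: eq_bigr => p pl; rewrite big_mkcond (bigD1_seq p.2) ?undup_uniq //=.
    by rewrite eqxx big1 ?addr0 // => a; rewrite eq_sym => /negbTE->.
  by rewrite mem_undup map_f.
- split; first by rewrite mem_undup map_f.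
  rewrite /c (big_rem p) //= eqxx ler_wpDr // big_seq_cond sumr_ge0 // => q.
  by move=> /andP[/mem_rem /l0].
Qed.

Lemma conePi : nonneg_combinations Pi = cone Pi.
Proof.
apply/seteqP; split=> [_ [r [c [hr hc ->]]]|_ [l hl ->]].
  exists [seq (c a, a) | a <- r]; last by rewrite big_map.
  by move=> _ /mapP[a ar ->] /=; split; [apply: hc|apply: hr].
have [r [c [_ hr hc -> _]]] := collect hl.
by exists r, c; split.
Qed.

(** The only use of positive independence. *)
Lemma cone_pointed x y : cone Pi x -> cone Pi y -> x + y = 0 -> x = 0.
Proof.
move=> [l hl ->] [l' hl' ->]; rewrite -big_cat => e.
have hll' p : p \in l ++ l' -> 0 <= p.1 /\ Pi p.2.
  by rewrite mem_cat => /orP[/hl|/hl'].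
have [r [c [ur hr hc ce hlr]]] := collect hll'; rewrite e in ce.
rewrite big_seq big1 // => p pl.
have [|pr pc] := hlr p; first by rewrite mem_cat pl.
have [ind _ _] := hPi.
have c0 := ind r c ur hr (fun a _ => hc a) (esym ce) _ pr.
have [p0 _] := hl p pl; suff -> : p.1 = 0 by rewrite scale0r.
by apply/eqP; rewrite eq_le p0 -c0 pc.
Qed.

Lemma posP b : Pos b <-> Phi b /\ cone Pi b.
Proof. by rewrite /positive_roots conePi. Qed.

Lemma simple_pos a : Pi a -> Pos a.
Proof. by move=> Pa; apply/posP; split; [apply: simple_root|apply: cone_gen]. Qed.

Lemma root_sign b : Phi b -> Pos b \/ Pos (- b).
Proof.
move=> hb; have := hb => /rootE[w [a [hw Pa e]]].
have [] := act_pos_or_neg hPi hw Pa; rewrite -e => h; [left|right]; apply/posP.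
  by [].
by split=> //; apply: root_opp.
Qed.

Lemma pos_opp b : Pos b -> ~ Pos (- b).
Proof.
move=> /posP[hb cb] /posP[_ cNb].
by have b0 := cone_pointed cb cNb (subrr b); apply: root0; rewrite -b0.
Qed.

Lemma simple_obtuse a b : Pi a -> Pi b -> a <> b -> B a b <= 0.
Proof.
move=> Pa Pb nab; have [_ _ /(_ a b Pa Pb nab)[[m m2 ->]|]] := hPi; last by lra.
have [h0 h1] := @angle_bounds R m m2.
rewrite oppr_le0; apply: cos_ge0_pihalf; rewrite h1 andbT.
by have := pi_gt0 R; lra.
Qed.

Lemma cone_obtuse a x : Pi a -> cone (Pi `\ a) x -> B x a <= 0.
Proof.
move=> Pa [l hl ->]; rewrite form_suml big_seq sumr_le0 // => p /hl[p0 [Pp pa]].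
by rewrite form_scalel mulr_ge0_le0 // simple_obtuse.
Qed.

(** A simple root spans an extreme ray of the cone: in a relation
    x + y = t a, remove the multiples of [a] from both summands; what remains
    pairs non-positively with [a], so that it cannot be a positive multiple of
    [a], and hence vanishes by pointedness. *)
Lemma simple_extreme a x y t : Pi a -> cone Pi x -> cone Pi y ->
  x + y = t *: a -> exists2 c, 0 <= c & x = c *: a.
Proof.
move=> Pa cx cy e.
have [c c0 [x' cx' xE]] := cone_split Pa cx.
have [d d0 [y' cy' yE]] := cone_split Pa cy.
pose u := t - c - d.
have xy' : x' + y' = u *: a.
  rewrite (_ : x' + y' = x + y - (c + d) *: a); last by rewrite xE yE; lincomb.
  by rewrite e /u; lincomb.
have sub z : cone (Pi `\ a) z -> cone Pi z by apply: sub_cone => b [].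
have u0 : u <= 0.
  have := cone_obtuse Pa (coneD cx' cy').
  by rewrite xy' form_scalel (simple_norm hPi) // mulr1.
have x0 : x' = 0.
  apply: (@cone_pointed _ (y' + (- u) *: a)).
  - exact: sub.
  - apply: coneD; first exact: sub.
    by apply: coneZ; [rewrite oppr_ge0|apply: cone_gen].
  - by rewrite addrA xy'; lincomb.
by exists c => //; rewrite xE x0 addr0.
Qed.

(** Two simple roots spanning a positive definite plane span a face of the
    cone, for the same reason. *)
Lemma simple_face a b x y p q : Pi a -> Pi b -> a <> b -> - 1 < B a b ->
  cone Pi x -> cone Pi y -> x + y = p *: a + q *: b ->
  exists c d, [/\ 0 <= c, 0 <= d & x = c *: a + d *: b].
Proof.
move=> Pa Pb nab hab cx cy e.
have Pba : (Pi `\ a) b by split=> // /esym.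
have split2 z : cone Pi z -> exists c d z', [/\ 0 <= c, 0 <= d,
    cone (Pi `\ a) z' /\ cone (Pi `\ b) z' & z = c *: a + d *: b + z'].
  move=> cz; have [c c0 [z1 cz1 ->]] := cone_split Pa cz.
  have [d d0 [z2 cz2 ->]] := cone_split Pba cz1.
  exists c, d, z2; split=> //; last by lincomb.
  by split; apply: sub_cone cz2 => v [[]].
have [c [d [x' [c0 d0 [x'a x'b] xE]]]] := split2 x cx.
have [c' [d' [y' [c0' d0' [y'a y'b] yE]]]] := split2 y cy.
pose u := p - c - c'; pose v := q - d - d'; pose z := x' + y'.
have zE : z = u *: a + v *: b.
  rewrite (_ : z = x + y - ((c + c') *: a + (d + d') *: b)).
    by rewrite e /u /v; lincomb.
  by rewrite /z xE yE; lincomb.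
have za : B z a <= 0 by apply: cone_obtuse => //; apply: coneD.
have zb : B z b <= 0 by apply: cone_obtuse => //; apply: coneD.
have aa := simple_norm hPi Pa; have bb := simple_norm hPi Pb.
have ab0 := simple_obtuse Pa Pb nab.
rewrite zE form_linl form_scalel aa (form_sym B b) in za.
rewrite zE form_linl form_scalel bb in zb.
have [u0 v0] : u <= 0 /\ v <= 0.
  move: (B a b) za zb hab ab0 => k *.
  split; rewrite leNgt; apply/negP => h0.
    have v0 : 0 < v by nra.
    by have := mulr_gt0 h0 v0; nra.
  have u0 : 0 < u by nra.
  by have := mulr_gt0 h0 u0; nra.
have sub e' z' : cone (Pi `\ e') z' -> cone Pi z' by apply: sub_cone => w [].
have x0 : x' = 0.
  apply: (@cone_pointed _ (y' + ((- u) *: a + (- v) *: b))).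
  - exact: sub x'a.
  - apply: coneD; first exact: sub y'a.
    by apply: cone_lin; rewrite ?oppr_ge0 //; apply: cone_gen.
  - by rewrite addrA -/z zE; lincomb.
by exists c, d; split=> //; rewrite xE x0 addr0.
Qed.

(** Finite sets of roots have extremal elements for this order, which replaces
    inductions on the depth of a root. *)
Definition cone_lt x y := cone Pi (y - x) /\ x <> y.

Lemma cone_lt_trans x y z : cone_lt x y -> cone_lt y z -> cone_lt x z.
Proof.
move=> [cxy nxy] [cyz nyz]; split.
  by rewrite -(subrK y z) -addrA; apply: coneD.
move=> exz; apply: nxy; apply/eqP; rewrite eq_sym -subr_eq0; apply/eqP.
by apply: (cone_pointed cxy cyz); rewrite exz; lincomb.
Qed.

Lemma cone_ltxx x : ~ cone_lt x x. Proof. by case. Qed.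

Definition span2 (a b : V) : set V :=
  [set v | Phi v /\ exists c d, [/\ 0 <= c, 0 <= d & v = c *: a + d *: b]].

(** If the plane were not positive definite, a root of the cone spanned by
    [a] and [b] which is maximal could still be raised by one of the two
    reflections. *)
Lemma finite_span2 a b : Pi a -> Pi b -> a <> b -> finite_set (span2 a b) ->
  - 1 < B a b.
Proof.
move=> Pa Pb nab fin.
have aa := simple_norm hPi Pa; have bb := simple_norm hPi Pb.
have [||//|x [hx [c [d [c0 d0 xE]]]] xmax] := finite_minimal
    (r := fun x y => cone_lt y x) _ _ fin.
- by move=> x y z xy yz; exact: cone_lt_trans yz xy.
- exact: cone_ltxx.
- exists a; split; first exact: simple_root.
  by exists 1, 0; rewrite ler01; split=> //; lincomb.
have raise e : Pi e -> (exists c d, [/\ 0 <= c, 0 <= d & e = c *: a + d *: b]) ->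
    0 <= B x e.
  move=> Pe [c' [d' [c0' d0' eE]]]; rewrite leNgt; apply/negP => xe.
  have t0 : 0 < - (2 * B x e) by lra.
  apply: (xmax (s e x)).
    split; first exact: root_reflection.
    exists (- (2 * B x e) * c' + c), (- (2 * B x e) * d' + d).
    split; [nra|nra|].
    by rewrite reflectionE {2}eE {2}xE; lincomb.
  have sxE : s e x - x = (- (2 * B x e)) *: e by rewrite reflectionE; lincomb.
  split; first by rewrite sxE; apply: coneZ; [exact: ltW|exact: cone_gen].
  move=> ex; move: sxE; rewrite -ex subrr => /esym/eqP; rewrite scaler_eq0.
  rewrite gt_eqF //= => /eqP e0; apply: root0; rewrite -e0; exact: simple_root.
have xa : 0 <= B x a by apply: raise => //; exists 1, 0; rewrite ler01; split=> //; lincomb.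
have xb : 0 <= B x b by apply: raise => //; exists 0, 1; rewrite ler01; split=> //; lincomb.
have x1 := root_norm hx.
have xx : c * B x a + d * B x b = 1.
  by rewrite -x1 (form_sym B x a) (form_sym B x b) -(form_scalel B d) -form_linl -xE.
have xaE : B x a = c + d * B a b.
  by rewrite xE form_linl form_scalel aa (form_sym B b); ring.
have xbE : B x b = c * B a b + d by rewrite xE form_linl form_scalel bb; ring.
rewrite {}xaE {}xbE in xa xb xx.
rewrite ltNge; apply/negP => k1; move: (B a b) xa xb xx k1 => k xa xb xx k1.
have := mulr_ge0 c0 d0; have := sqr_ge0 (c - d).
by clear -xx k1 xa xb c0 d0; nra.
Qed.

(** Otherwise [b] and the opposite of [s a b] would be two elements of the cone
    whose sum lies on the extreme ray of [a]. *)
Lemma simple_reflection_pos a b : Pi a -> Pos b -> b <> a -> Pos (s a b).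
Proof.
move=> Pa hb nba; have /posP[rb cb] := hb.
have [//|/posP[_ cN]] := root_sign (root_reflection Pa rb).
have [|c c0 bE] := simple_extreme (t := 2 * B b a) Pa cb cN.
  by rewrite /reflection; lincomb.
case: nba; rewrite bE in rb *.
by rewrite (root_scale (simple_root Pa) c0 rb) scale1r.
Qed.

End Roots.

(** * Closed sets of roots *)

Section ClosedSets.
Variables (R : realType) (V : lmodType R) (B : {symmetric V}) (Pi : set V).
Hypothesis hPi : simple_roots B Pi.
Local Notation s := (reflection B).
Local Notation act := (wact B).
Local Notation Phi := (Defs.roots B Pi).
Local Notation Pos := (positive_roots B Pi).
Local Notation closed := (closed_roots B Pi).
Local Notation cl := (root_closure B Pi).
Implicit Types (A C D E : set V).

Lemma closed_root A x : closed A -> A x -> Phi x.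
Proof. by case=> h _ /h. Qed.

Lemma closed_Phi : closed Phi.
Proof. by split. Qed.

Lemma closedI A C : closed A -> closed C -> closed (A `&` C).
Proof.
move=> [sA cA] [_ cC]; split; first by move=> x [/sA].
move=> a b [Aa Ca] [Ab Cb] x y x0 y0 h.
by split; [apply: cA|apply: cC].
Qed.

Lemma cl_min A C : closed C -> A `<=` C -> cl A `<=` C.
Proof. exact: smallest_sub. Qed.

Lemma sub_cl A : A `<=` cl A.
Proof. exact: sub_gen_smallest. Qed.

Lemma cl_closed A : A `<=` Phi -> closed (cl A).
Proof.
move=> sA; split; first exact: cl_min closed_Phi sA.
move=> a b ca cb x y x0 y0 h C [[sC cC] AC].
by apply: (cC a b _ _ x y x0 y0 h); [exact: ca|exact: cb].
Qed.

Lemma cl_mono A C : C `<=` Phi -> A `<=` C -> cl A `<=` cl C.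
Proof.
by move=> sC AC; apply: cl_min (cl_closed sC) _ => x /AC /sub_cl.
Qed.

Lemma cl_id A : closed A -> cl A = A.
Proof. exact: smallest_id. Qed.

Lemma scale_root t x : Phi x -> 0 <= t -> Phi (t *: x) -> t *: x = x.
Proof. by move=> hx t0 /(root_scale hPi hx t0) ->; rewrite scale1r. Qed.

Definition opp_set A : set V := [set x | A (- x)].

Lemma closed_opp A : closed A -> closed (opp_set A).
Proof.
move=> [sA cA]; split; first by move=> x /sA /(root_oppE hPi).
move=> a b Aa Ab x y x0 y0 h; rewrite /opp_set /=.
have -> : - (x *: a + y *: b) = x *: - a + y *: - b by lincomb.
apply: cA => //; rewrite (_ : _ + _ = - (x *: a + y *: b)); last by lincomb.
exact: root_opp.
Qed.

(** Positive systems, without reference to the group. *)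
Definition psys C :=
  [/\ closed C, forall x, Phi x -> C x \/ C (- x) & forall x, C x -> ~ C (- x)].

Lemma psys_opp C x : psys C -> Phi x -> C (- x) <-> ~ C x.
Proof.
move=> [_ hC nC] hx; split=> [h1 h2|h]; first exact: nC h2 h1.
by have [] := hC x hx.
Qed.

Lemma psys_eq C D : psys C -> psys D -> C `<=` D -> C = D.
Proof.
move=> hC [[sD _] _ nD] CD; apply/seteqP; split=> // x Dx.
have [_ /(_ x (sD x Dx)) [//|/CD h] _] := hC.
by have := nD x Dx.
Qed.

Lemma pos_psys : psys Pos.
Proof.
split; last by move=> x; apply: (pos_opp hPi).
- split; first by move=> x [].
  move=> a b /posP[_ ca] /posP[_ cb] x y x0 y0 h.
  by apply/posP; split=> //; apply: cone_lin.
- by move=> x; apply: (root_sign hPi).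
Qed.

Lemma psys_act w C : word Pi w -> psys C -> psys [set x | C (act w x)].
Proof.
move=> hw [[sC cC] hC nC]; have uw := word_unit hPi hw.
split; last by move=> x; rewrite /= wactN; apply: nC.
- split.
    move=> x /sC hx; rewrite -(wactK uw x).
    by apply: (root_act hPi) => //; exact: word_rev.
  move=> a b Ca Cb x y x0 y0 h; rewrite /= wactD !wactZ; apply: cC => //.
  by rewrite -!wactZ -wactD; apply: (root_act hPi).
- by move=> x hx; rewrite /= wactN; apply: hC; apply: (root_act hPi).
Qed.

(** If [A] is the set of roots of a chamber [E] that separate it from another
    chamber, this is the other chamber. *)
Definition flip E A : set V := (E `\` A) `|` opp_set A.

(** A sum of an element kept and an element flipped cannot leave [flip E A]:
    otherwise moving one term to the other side would break the closure of
    [A] or of its complement. *)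
Lemma flip_psys E A : psys E -> closed A -> A `<=` E -> closed (E `\` A) ->
  psys (flip E A).
Proof.
move=> pE cA AE cEA; have [[sE cE] hE nE] := pE.
have mixed a b x y : (E `\` A) a -> A (- b) -> 0 <= x -> 0 <= y ->
    Phi (x *: a + y *: b) -> flip E A (x *: a + y *: b).
  move=> [Ea nAa] Ab x0 y0 h; set c := x *: a + y *: b.
  have [Ec|ENc] := hE c h.
    have [Ac|nAc] := pselect (A c); last by left.
    have [x00|nx0] := eqVneq x 0.
      have cb : c = y *: b by rewrite /c x00; lincomb.
      have hb : Phi b by apply: (root_oppE hPi); exact/sE/AE.
      rewrite cb scale_root // -?cb // in Ec.
      by case: (nE b Ec); exact: AE.
    exfalso; apply: nAa; case: cA => _ cA.
    have xp : 0 < x by rewrite lt_def nx0.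
    have aE : a = x^-1 *: c + (x^-1 * y) *: - b.
      rewrite (_ : _ + _ = (x^-1 * x) *: a); first by rewrite mulVf // scale1r.
      by rewrite /c; lincomb.
    rewrite aE; apply: cA; rewrite -?aE ?mulr_ge0 ?invr_ge0 //.
    exact: sE.
  have [ANc|nANc] := pselect (A (- c)); first by right.
  have [y00|ny0] := eqVneq y 0.
    have cb : c = x *: a by rewrite /c y00; lincomb.
    by rewrite cb scale_root // -?cb //; [left|exact: sE].
  have yp : 0 < y by rewrite lt_def ny0.
  case: cEA => _ cEA.
  have bE : - b = y^-1 *: - c + (y^-1 * x) *: a.
    rewrite (_ : _ + _ = (y^-1 * y) *: - b); first by rewrite mulVf // scale1r.
    by rewrite /c; lincomb.
  suff: (E `\` A) (- b) by case.
  rewrite bE; apply: cEA; rewrite -?bE ?mulr_ge0 ?invr_ge0 //.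
  exact/sE/AE.
split.
- split.
    by move=> x [[/sE]|/AE /sE /(root_oppE hPi)].
  move=> a b [Ea|Aa] [Eb|Ab] x y x0 y0 h.
  + by left; case: cEA => _ cEA; apply: cEA.
  + exact: mixed.
  + by rewrite addrC; apply: mixed => //; rewrite addrC.
  + right; have [_ cA'] := closed_opp cA.
    exact: cA'.
- move=> x hx; have [Ex|ENx] := hE x hx.
    have [Ax|nAx] := pselect (A x); last by left; left.
    by right; right; rewrite /opp_set /= opprK.
  have [Ax|nAx] := pselect (A (- x)); last by right; left.
  by left; right.
- move=> x [[Ex nAx]|Ax] [[ENx nANx]|]; rewrite /opp_set /= ?opprK //.
    exact: nE Ex ENx.
  by move=> /AE Ex; apply: (nE x) => //; apply: AE.
Qed.

End ClosedSets.

(** * Chambers *)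

Section Chambers.
Variables (R : realType) (V : lmodType R) (B : {symmetric V}) (Pi : set V).
Hypothesis hPi : simple_roots B Pi.
Local Notation s := (reflection B).
Local Notation act := (wact B).
Local Notation Phi := (Defs.roots B Pi).
Local Notation Pos := (positive_roots B Pi).
Local Notation closed := (closed_roots B Pi).
Local Notation cl := (root_closure B Pi).
Local Notation psys := (psys B Pi).
Implicit Types (A C D E U : set V).

(** The positive systems of the Weyl chambers, i.e. the images of the positive
    roots under the group, written as preimages. *)
Definition chamber C := exists2 w, word Pi w & C = [set x | Pos (act w x)].

Lemma chamber_pos : chamber Pos.
Proof. by exists [::] => //; apply/seteqP; split. Qed.

Lemma chamber_act w C : word Pi w -> chamber C -> chamber [set x | C (act w x)].
Proof.
move=> hw [w' hw' ->]; exists (w' ++ w); first exact: word_cat.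
by apply/seteqP; split=> x; rewrite /= wact_cat.
Qed.

Lemma chamber_psys C : chamber C -> psys C.
Proof. by move=> [w hw ->]; apply: psys_act => //; apply: pos_psys. Qed.

Lemma chamber_closed C : chamber C -> closed C.
Proof. by move=> /chamber_psys[]. Qed.

Lemma chamber_root C x : chamber C -> C x -> Phi x.
Proof. by move=> /chamber_closed; apply: closed_root. Qed.

Lemma chamber_opp C x : chamber C -> Phi x -> C (- x) <-> ~ C x.
Proof. by move=> /chamber_psys; apply: psys_opp. Qed.

Lemma chamber_notN C x : chamber C -> C x -> ~ C (- x).
Proof. by move=> /chamber_psys[_ _]; apply. Qed.

Lemma chamber_oppC C x : chamber C -> Phi x -> ~ C x -> C (- x).
Proof. by move=> hC hx /(chamber_opp hC hx). Qed.

Lemma chamber_setD C D : chamber C -> chamber D -> C `\` D = C `&` opp_set D.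
Proof.
move=> hC hD; apply/seteqP; split=> x [Cx]; have hx := chamber_root hC Cx.
  by move=> /(chamber_opp hD hx).
by move=> /(chamber_opp hD hx).
Qed.

Lemma closed_setD C D : chamber C -> chamber D -> closed (C `\` D).
Proof.
move=> hC hD; rewrite chamber_setD //; apply: closedI; first exact: chamber_closed.
by apply: closed_opp => //; exact: chamber_closed.
Qed.

(** Each letter of a word changes the sign of one root up to opposites. *)
Lemma finite_setD_chamber C D : chamber C -> chamber D -> finite_set (C `\` D).
Proof.
have base w : word Pi w -> finite_set (Pos `\` [set x | Pos (act w x)]).
  elim: w => [_|a w IH hw]; first by apply: sub_finite_set (finite_set0 V) => x [].
  have hw' : word Pi w by move=> b bw; apply: hw; rewrite inE bw orbT.
  have Pa : Pi a by apply: hw; exact: mem_head.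
  apply: (@sub_finite_set _ _ ((Pos `\` [set x | Pos (act w x)])
                               `|` [set act (rev w) a])); last first.
    by rewrite finite_setU; split; [exact: IH|exact: finite_set1].
  move=> x [hx nx]; have [wx|] := pselect (Pos (act w x)); last by left.
  right; have [<-|nwa] := pselect (act w x = a).
    by rewrite /= wactK //; exact: (word_unit hPi).
  by case: nx; exact: (simple_reflection_pos hPi).
move=> [w hw ->] [w' hw' ->]; have uw := word_unit hPi hw.
have fin := base (w' ++ rev w) (word_cat hw' (word_rev hw)).
apply: sub_finite_set (finite_image (act (rev w)) fin) => x [hx nx].
exists (act w x); last by rewrite wactK.
by split=> //; rewrite /= wact_cat wactK.
Qed.

(** Pair [x] with its own expression as a combination of simple roots. *)
Lemma form_pos_simple x : cone Pi x -> 0 < B x x -> exists2 a, Pi a & 0 < B x a.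
Proof.
move=> [l hl e] xx; apply: contrapT => h.
suff : B x x <= 0 by rewrite leNgt xx.
rewrite {2}e form_sym form_suml big_seq sumr_le0 // => p /hl[p0 Pp].
rewrite form_scalel mulr_ge0_le0 // form_sym leNgt; apply/negP => px.
by apply: h; exists p.2.
Qed.

(** If all simple roots were in [C], then a lowest positive root outside [C]
    would be the sum of a lower one and of a multiple of a simple root. *)
Lemma simple_notin C : psys C -> finite_set (Pos `\` C) -> Pos `\` C !=set0 ->
  exists2 a, Pi a & ~ C a.
Proof.
move=> pC fin ne; apply: contrapT => nex.
have PC a : Pi a -> C a by move=> Pa; apply: contrapT => nCa; apply: nex; exists a.
have [b [pb nCb] bmin] := finite_minimal
  (@cone_lt_trans _ _ _ _ hPi) (@cone_ltxx _ _ _) fin ne.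
have /posP[rb cb] := pb; have b1 := root_norm hPi rb.
have [|a Pa ba] := form_pos_simple cb; first by rewrite b1.
have nba : b <> a by move=> ba'; apply: nCb; rewrite ba'; exact: PC.
have psb := simple_reflection_pos hPi Pa pb nba.
have bE : b = 1 *: s a b + (2 * B b a) *: a by rewrite /reflection; lincomb.
have t0 : 0 <= 2 * B b a by rewrite mulr_ge0 // ltW.
have [Csb|nCsb] := pselect (C (s a b)).
  case: pC => -[_ cC] _ _; apply: nCb; rewrite bE; apply: cC => //.
    exact: PC.
  by rewrite -bE.
have subE : b - s a b = (2 * B b a) *: a by rewrite /reflection; lincomb.
apply: (bmin (s a b)) => //; split.
  by rewrite subE; apply: coneZ => //; exact: cone_gen.
move=> e; move: subE; rewrite e subrr => /esym/eqP.
rewrite scaler_eq0 mulf_eq0 pnatr_eq0 (gt_eqF ba) /= => /eqP a0.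
by apply: (root0 hPi); rewrite -a0; exact: simple_root.
Qed.

Lemma flip1E E d x : flip E [set d] x <-> (E x /\ x <> d) \/ x = - d.
Proof.
rewrite /flip /opp_set /=; split=> -[h|h]; [by left| |by left|].
  by right; rewrite -h opprK.
by right; rewrite h opprK.
Qed.

(** As [s a] permutes the positive roots other than [a], a new letter changes the
    sign of a single root. *)
Lemma flip_word w d : word Pi w -> Pi (act w d) ->
  flip [set x | Pos (act w x)] [set d] = [set x | Pos (act (act w d :: w) x)].
Proof.
move=> hw Pa; have uw := word_unit hPi hw; have a1 := simple_norm hPi Pa.
have inj x y : act w x = act w y -> x = y.
  by move=> e; rewrite -(wactK uw x) e wactK.
apply/seteqP; split=> x; rewrite flip1E /=.
  move=> [[hx nxd]|->].
    by apply: (simple_reflection_pos hPi) => // /inj.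
  by rewrite wactN -{1}(reflection_self a1) reflectionK //; exact: simple_pos.
move=> h; have [e|ne] := pselect (act w x = - act w d).
  by right; apply: inj; rewrite wactN.
left; split; last first.
  move=> e; move: h; rewrite e reflection_self //.
  exact/(pos_opp hPi)/simple_pos.
rewrite -[act w x](reflectionK a1); apply: (simple_reflection_pos hPi) => // e.
by apply: ne; rewrite -[LHS](reflectionK a1) e reflection_self.
Qed.

(** Galleries: a positive system at finite distance from a chamber is reached
    from it by crossing walls one at a time. *)
Lemma psys_chamber C : psys C -> finite_set (Pos `\` C) -> chamber C.
Proof.
move=> pC; suff gen A : finite_set A -> forall w, word Pi w ->
    [set x | Pos (act w x)] `\` C = A -> chamber C.
  move=> fin; have [w hw e] := chamber_pos; rewrite e in fin.
  exact: (gen _ fin w hw).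
move: A; apply: finite_subset_ind => A fA IH w hw eA.
have uw := word_unit hPi hw; have hrw := word_rev hw.
have pE : psys [set x | Pos (act w x)] by apply: psys_act => //; exact: pos_psys.
have [[z Az]|A0] := pselect (A !=set0); last first.
  exists w => //; apply/esym/(psys_eq pE pC) => x wx; apply: contrapT => nCx.
  by apply: A0; exists x; rewrite -eA.
have [|||a Pa nCa] := @simple_notin [set x | C (act (rev w) x)].
- exact: psys_act.
- apply: sub_finite_set (finite_image (act w) fA) => x [px nCx].
  exists (act (rev w) x); last exact: wactVK.
  by rewrite -eA; split=> //=; rewrite wactVK.
- by exists (act w z); move: Az; rewrite -eA => -[wz nCz]; split; rewrite //= wactK.
pose d := act (rev w) a; have wd : act w d = a by rewrite /d wactVK.
have Cd : C (- d).
  apply/(psys_opp pC) => //; apply: (root_act hPi) => //; exact: simple_root.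
have eE := flip_word hw (d := d); rewrite wd in eE; have {}eE := eE Pa.
apply: (IH _ _ (a :: w) (word_cons Pa hw) erefl); rewrite -eE -eA.
split=> [x [/flip1E[[wx _]|->//] nCx]|h]; first by [].
have [|/flip1E[[//]|/esym dE] _] := h d.
  by split=> //=; rewrite wd; exact: simple_pos.
apply: (@root0 _ _ _ _ hPi).
have d0 : d = 0.
  have : (1 + 1) *: d = 0 by rewrite scalerDl scale1r -{2}dE subrr.
  by move=> /eqP; rewrite scaler_eq0 -mulr2n pnatr_eq0 /= => /eqP.
by rewrite -(wact0 B w) -d0 wd; exact: simple_root.
Qed.

Lemma psys_near_chamber E C : chamber E -> psys C -> finite_set (E `\` C) ->
  chamber C.
Proof.
move=> hE pC fin; apply: psys_chamber => //.
apply: (@sub_finite_set _ _ ((Pos `\` E) `|` (E `\` C))); last first.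
  by rewrite finite_setU; split=> //; apply: finite_setD_chamber => //;
     exact: chamber_pos.
move=> x [px nCx]; have [Ex|nEx] := pselect (E x); first by right.
by left.
Qed.

(** The roots of [E] that can be crossed: the simple roots of [E]. *)
Definition wall E d := [/\ chamber E, E d & chamber (flip E [set d])].

Lemma wall_word w d : word Pi w -> Pi (act w d) -> wall [set x | Pos (act w x)] d.
Proof.
move=> hw Pa; split; first by exists w.
  exact: simple_pos.
rewrite flip_word //; exists (act w d :: w) => //; exact: word_cons.
Qed.

(** The neighbour across [d] misses a simple root of the chamber of [w], and [d] is
    the only root that it misses. *)
Lemma wallP w d : word Pi w -> wall [set x | Pos (act w x)] d -> Pi (act w d).
Proof.
move=> hw [_ pd hC]; set C := flip _ _ in hC; have hrw := word_rev hw.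
have uw := word_unit hPi hw.
have hC' := chamber_act hrw hC.
have PosC' x : Pos x -> ~ C (act (rev w) x) -> x = act w d.
  move=> px nCx; apply: contrapT => ne; apply: nCx; apply/flip1E; left.
  split; first by rewrite /= wactVK.
  by move=> e; apply: ne; rewrite -e wactVK.
have nCd : ~ C d.
  by move=> /flip1E[[]//|e]; case: (pos_opp hPi pd); rewrite -wactN -e.
have [|||a Pa nCa] := @simple_notin [set x | C (act (rev w) x)].
- exact: chamber_psys.
- by apply: finite_setD_chamber => //; exact: chamber_pos.
- by exists (act w d); split=> //=; rewrite wactK.
by rewrite -(PosC' a) //; exact: simple_pos.
Qed.

Lemma wall_exists E C : chamber E -> chamber C -> E `\` C !=set0 ->
  exists2 d, wall E d & ~ C d.
Proof.
move=> hE hC [x [Ex nCx]]; have [w hw eE] := hE; have hrw := word_rev hw.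
have uw := word_unit hPi hw.
have hC' := chamber_act hrw hC.
have [|||a Pa nCa] := @simple_notin [set x | C (act (rev w) x)].
- exact: chamber_psys.
- by apply: finite_setD_chamber => //; exact: chamber_pos.
- by exists (act w x); split; [move: Ex; rewrite eE|rewrite /= wactK].
exists (act (rev w) a) => //; rewrite eE; apply: wall_word => //.
by rewrite wactVK.
Qed.

Lemma wall_extreme E d x y p q : wall E d -> E x -> E y -> 0 < p -> 0 <= q ->
  p *: x + q *: y = d -> x = d.
Proof.
move=> hd Ex Ey p0 q0 e; have [[w hw eE] Ed _] := hd; have uw := word_unit hPi hw.
have Pa : Pi (act w d) by apply: wallP; rewrite -?eE.
move: Ex Ey Ed; rewrite eE /= => /posP[rx cx] /posP[ry cy] /posP[rd _].
have [|c c0 xE] := simple_extreme (x := p *: act w x) (y := q *: act w y)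
    (t := 1) hPi Pa (coneZ (ltW p0) cx) (coneZ q0 cy).
  by rewrite -!wactZ -wactD e scale1r.
have wxE : act w x = (p^-1 * c) *: act w d.
  by rewrite -scalerA -xE scalerA mulVf ?gt_eqF // scale1r.
have t0 : 0 <= p^-1 * c by rewrite mulr_ge0 // invr_ge0 ltW.
have xdE : act w x = act w d.
  by rewrite wxE; apply: (scale_root hPi rd t0); rewrite -wxE.
by rewrite -(wactK uw x) xdE wactK.
Qed.

Lemma wall_face E d e x y p q : wall E d -> wall E e -> d <> e ->
  finite_set (span2 B Pi d e) -> E x -> E y -> 0 < p -> 0 <= q ->
  span2 B Pi d e (p *: x + q *: y) -> span2 B Pi d e x.
Proof.
move=> hd he nde fin Ex Ey p0 q0 [_ [c [c' [c0 c0' sE]]]].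
have [hE Ed _] := hd; have [w hw eE] := hE; have uw := word_unit hPi hw.
have hx := chamber_root hE Ex; have hrw := word_rev hw.
have Pa : Pi (act w d) by apply: wallP; rewrite -?eE.
have Pb : Pi (act w e) by apply: wallP; rewrite -?eE.
have nab : act w d <> act w e by move=> e1; apply: nde; rewrite -(wactK uw d) e1 wactK.
have hab : - 1 < B (act w d) (act w e).
  apply: (finite_span2 hPi) => //.
  apply: sub_finite_set (finite_image (act w) fin) => v [hv [t [u [t0 u0 vE]]]].
  exists (act (rev w) v); last exact: wactVK.
  split; first exact: root_act.
  by exists t, u; split=> //; rewrite vE wactD !wactZ !wactK.
move: Ex Ey; rewrite eE /= => /posP[_ cx] /posP[_ cy].
have [|t [u [t0 u0 tuE]]] := simple_face (x := p *: act w x) (y := q *: act w y)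
    (p := c) (q := c') hPi Pa Pb nab hab (coneZ (ltW p0) cx) (coneZ q0 cy).
  by rewrite -!wactZ -!wactD sE.
have pV0 : 0 <= p^-1 by rewrite invr_ge0 ltW.
split=> //; exists (p^-1 * t), (p^-1 * u); split; [exact: mulr_ge0|exact: mulr_ge0|].
have {tuE} : p *: x = t *: d + u *: e.
  by rewrite -(wactK uw (p *: x)) wactZ tuE wactD !wactZ !wactK.
by move=> h; rewrite -!scalerA -scalerDr -h scalerA mulVf ?gt_eqF // scale1r.
Qed.

Lemma closed_span2 d e : closed (span2 B Pi d e).
Proof.
split; first by move=> x [].
move=> a b [ra [c [c' [c0 c0' aE]]]] [rb [t [t' [t0 t0' bE]]]] x y x0 y0 h.
split=> //; exists (x * c + y * t), (x * c' + y * t').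
by split; [rewrite addr_ge0 ?mulr_ge0|rewrite addr_ge0 ?mulr_ge0|rewrite aE bE; lincomb].
Qed.

Lemma span2_sub E d e : wall E d -> wall E e -> span2 B Pi d e `<=` E.
Proof.
move=> [hE Ed _] [_ Ee _] x [h [c [c' [c0 c0' xE]]]]; rewrite xE in h *.
by have [_] := chamber_closed hE; apply.
Qed.

Lemma span2l E d e : wall E d -> span2 B Pi d e d.
Proof.
move=> [hE Ed _]; split; first exact: chamber_root Ed.
by exists 1, 0; split=> //; lincomb.
Qed.

Lemma span2r E d e : wall E e -> span2 B Pi d e e.
Proof.
move=> [hE Ee _]; split; first exact: chamber_root Ee.
by exists 0, 1; split=> //; lincomb.
Qed.

Lemma closed_setD_wall E d : wall E d -> closed (E `\ d).
Proof.
move=> hd; have [hE Ed hF] := hd.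
have -> : E `\ d = E `&` flip E [set d].
  apply/seteqP; split=> x [Ex h]; split=> //; first by apply/flip1E; left.
  move: h => /flip1E[[_ //]|xd] xd'; rewrite xd' in xd.
  by case: (chamber_notN hE Ed); rewrite -xd.
by apply: closedI; exact: chamber_closed.
Qed.

Section TwoWalls.
Variables (E : set V) (d e : V).
Hypotheses (hd : wall E d) (he : wall E e) (nde : d <> e).
Hypothesis fin : finite_set (span2 B Pi d e).
Local Notation S := (span2 B Pi d e).

(** The roots spanned by two simple roots form a face of the cone, so that both
    they and the other roots of [E] are closed. *)
Lemma chamber_flip_span : chamber (flip E S).
Proof.
have hE : chamber E by case: hd.
have SE := span2_sub hd he.
apply: (psys_near_chamber hE).
  apply: (flip_psys hPi) => //; first exact: chamber_psys.
    exact: closed_span2.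
  split; first by move=> x [/(chamber_root hE)].
  move=> x y [Ex nSx] [Ey nSy] p q p0 q0 h.
  have [_ cE] := chamber_closed hE; split; first exact: cE.
  move=> Spq; have [p00|np0] := eqVneq p 0.
    have [q00|nq0] := eqVneq q 0.
      apply: (root0 hPi); rewrite (_ : 0 = p *: x + q *: y) //.
      by rewrite p00 q00; lincomb.
    apply: nSy; apply: (wall_face (x := y) (y := x) (p := q) (q := p) hd he) => //.
      by rewrite lt_def nq0.
    by rewrite addrC.
  apply: nSx; apply: (wall_face (p := p) (q := q) hd he nde fin Ex Ey) => //.
  by rewrite lt_def np0.
apply: sub_finite_set fin => x [Ex nF]; apply: contrapT => nSx.
by apply: nF; left.
Qed.

(** The same holds without [d], which is extreme. *)
Lemma chamber_flip_spanD : chamber (flip E (S `\ d)).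
Proof.
have hE : chamber E by case: hd.
have SE := span2_sub hd he.
have SdE : S `\ d `<=` E by move=> x [/SE].
have key x y p q : E x -> ~ (S `\ d) x -> E y -> ~ (S `\ d) y -> 0 <= p ->
    0 <= q -> Phi (p *: x + q *: y) -> ~ (S `\ d) (p *: x + q *: y).
  move=> Ex nx Ey ny p0 q0 h [Spq npq].
  have px : p = 0 \/ x = d.
    have [->|np0] := eqVneq p 0; [by left|right]; apply: contrapT => nxd; apply: nx.
    split=> //; apply: (wall_face (p := p) (q := q) hd he nde fin Ex Ey) => //.
    by rewrite lt_def np0.
  have qy : q = 0 \/ y = d.
    have [->|nq0] := eqVneq q 0; [by left|right]; apply: contrapT => nyd; apply: ny.
    split=> //; apply: (wall_face (p := q) (q := p) hd he nde fin Ey Ex) => //.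
      by rewrite lt_def nq0.
    by rewrite addrC.
  have [t t0 tE] : exists2 t, 0 <= t & p *: x + q *: y = t *: d.
    case: px => ->; case: qy => ->.
    - by exists 0 => //; lincomb.
    - by exists q => //; lincomb.
    - by exists p => //; lincomb.
    - by exists (p + q); [rewrite addr_ge0|lincomb].
  apply: npq; rewrite /= tE; apply: (scale_root hPi) => //; last by rewrite -tE.
  by case: hd => _ Ed _; exact: chamber_root Ed.
apply: (psys_near_chamber hE); last first.
  apply: sub_finite_set fin => x [Ex nF]; apply: contrapT => nSx.
  by apply: nF; left; split=> // -[].
apply: (flip_psys hPi) => //; first exact: chamber_psys.
- have -> : S `\ d = S `&` (E `\ d).
    by apply/seteqP; split=> x [Sx h]; split=> //; [split=> //; apply: SE|case: h].
  by apply: closedI; [exact: closed_span2|exact: closed_setD_wall].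
- split; first by move=> x [/(chamber_root hE)].
  move=> x y [Ex nSx] [Ey nSy] p q p0 q0 h.
  by have [_ cE] := chamber_closed hE; split; [exact: cE|exact: key].
Qed.

(** The flips of all the spanned roots, and of all of them but [d], are adjacent. *)
Lemma flip_spanD_wall : wall (flip E (S `\ d)) d.
Proof.
have [hE Ed hF] := hd; split; first exact: chamber_flip_spanD.
  by left; split=> //; case=> _; apply.
have -> : flip (flip E (S `\ d)) [set d] = flip E S; last exact: chamber_flip_span.
have Sd : S d by exact: span2l hd.
have nEd := chamber_notN hE Ed.
apply/seteqP; split=> x.
  rewrite flip1E => -[[[[Ex nSd]|[Sx _]] nx]|->].
  - by left; split=> // Sx; apply: nSd; split.
  - by right.
  - by right; rewrite /opp_set /= opprK.
move=> [[Ex nSx]|Sx]; rewrite flip1E.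
  by left; split; [left; split=> // -[]|move=> xd; apply: nSx; rewrite xd].
have [xd|nxd] := pselect (x = - d); first by right.
left; split; last by move=> xd; apply: nEd; rewrite -xd; apply: (span2_sub hd he).
by right; split=> //= e1; apply: nxd; rewrite -e1 opprK.
Qed.

End TwoWalls.

End Chambers.

(** * Joins and meets of chambers *)

Section ChamberLattice.
Variables (R : realType) (V : lmodType R) (B : {symmetric V}) (Pi : set V).
Hypothesis hPi : simple_roots B Pi.
Local Notation Phi := (Defs.roots B Pi).
Local Notation Pos := (positive_roots B Pi).
Local Notation closed := (closed_roots B Pi).
Local Notation cl := (root_closure B Pi).
Local Notation chamber := (chamber B Pi).
Local Notation wall := (wall B Pi).
Local Notation S := (span2 B Pi).
Implicit Types (C D E F G K P U X Y Z : set V).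

Lemma cl_eq A C : closed C -> A `<=` C -> C `<=` cl A -> C = cl A.
Proof. by move=> hC AC CA; apply/seteqP; split=> //; exact: cl_min. Qed.

Lemma chamber_sub E A : chamber E -> A `<=` E -> A `<=` Phi.
Proof. by move=> hE AE x /AE /(chamber_root hPi hE). Qed.

Lemma setD0_chamber E C : chamber E -> chamber C -> ~ (E `\` C !=set0) -> E = C.
Proof.
move=> hE hC h; apply: (psys_eq (chamber_psys hPi hE) (chamber_psys hPi hC)).
by move=> x Ex; apply: contrapT => nCx; apply: h; exists x.
Qed.

Lemma span2_min d e A : closed A -> A d -> A e -> S d e `<=` A.
Proof.
move=> [_ cA] Ad Ae x [h [c [c' [c0 c0' xE]]]]; rewrite xE in h *.
exact: cA.
Qed.

Lemma flip1_neq E d : wall E d -> ~ flip E [set d] d.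
Proof.
move=> [hE Ed _] /flip1E[[]//|dE].
by apply: (chamber_notN hPi hE Ed); rewrite -dE.
Qed.

Lemma flip1_sub E C d : chamber C -> wall E d -> ~ C d ->
  flip E [set d] `\` C `<` E `\` C.
Proof.
move=> hC hd nCd; have [hE Ed _] := hd; split.
  move=> x [/flip1E[[Ex _]|xd] nCx]; first by split.
  case: nCx; rewrite xd; apply: (chamber_oppC hPi hC) => //.
  exact: (chamber_root hPi hE Ed).
by move=> h; have [|/(flip1_neq hd)] := h d.
Qed.

(** Moving the base [E] across a wall which separates it from [X] and [Y] only
    adds the root of that wall to all the sets involved. *)
Lemma join_peel E U X Y Z d : wall E d -> chamber U -> chamber X -> chamber Y ->
  chamber Z -> ~ X d -> ~ Y d -> ~ U d ->
  flip E [set d] `&` U `<=` Z ->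
  flip E [set d] `\` Z = cl ((flip E [set d] `\` X) `|` (flip E [set d] `\` Y)) ->
  E `&` U `<=` Z /\ E `\` Z = cl ((E `\` X) `|` (E `\` Y)).
Proof.
move=> hd hU hX hY hZ nXd nYd nUd UZ ZE; have [hE Ed _] := hd.
have hrd := chamber_root hPi hE Ed.
have ndZ : ~ Z d.
  apply/(chamber_opp hPi hZ hrd)/UZ; split; first by apply/flip1E; right.
  exact: (chamber_oppC hPi).
have sub C : chamber C -> ~ C d -> flip E [set d] `\` C `<=` E `\` C.
  by move=> hC nCd; have [] := flip1_sub hC hd nCd.
have sub' C x : E x -> ~ C x -> x <> d -> (flip E [set d] `\` C) x.
  by move=> Ex nCx nx; split=> //; apply/flip1E; left.
split.
  move=> x [Ex Ux]; apply: UZ; split=> //; apply/flip1E; left; split=> // xd.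
  by apply: nUd; rewrite -xd.
apply: cl_eq; first exact: (closed_setD hPi).
  have aux C : flip E [set d] `\` C `<=` flip E [set d] `\` Z ->
      E `\` C `<=` E `\` Z.
    move=> h x [Ex nCx]; split=> //; have [->//|nx] := pselect (x = d).
    by have [] := h x (sub' C x Ex nCx nx).
  by move=> x [|]; apply: aux => y hy; rewrite ZE; apply: sub_cl; [left|right].
move=> x [Ex nZx]; have [->|nx] := pselect (x = d).
  by apply: sub_cl; left; split.
have := sub' Z x Ex nZx nx; rewrite ZE; apply: cl_mono.
  by apply: (chamber_sub hE) => y [[]|[]].
by move=> y [/(sub X hX nXd)|/(sub Y hY nYd)]; [left|right].
Qed.

(** Joins in an interval, by induction on the interval. If one wall of the base
    separates it from both [X] and [Y], move the base. If the first walls towards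
    [X] and towards [Y] differ, go through the dihedral chamber [F] opposite to
    the base: [X] and [F] have a common first wall, and then so do their join
    and [Y]. *)
Theorem join_interval E U X Y : chamber E -> chamber U -> chamber X ->
  chamber Y -> E `&` U `<=` X -> E `&` U `<=` Y ->
  exists2 Z, chamber Z & E `&` U `<=` Z /\ E `\` Z = cl ((E `\` X) `|` (E `\` Y)).
Proof.
move=> hE hU; have [A] : exists A, A = E `\` U by exists (E `\` U).
move=> eA; have fA : finite_set A by rewrite eA; exact: (finite_setD_chamber hPi).
move: A fA E eA hE X Y; apply: finite_subset_ind => A fA IH E eA hE.
have common X Y d : chamber X -> chamber Y -> E `&` U `<=` X -> E `&` U `<=` Y ->
    wall E d -> ~ X d -> ~ Y d -> exists2 Z, chamber Z &
    E `&` U `<=` Z /\ E `\` Z = cl ((E `\` X) `|` (E `\` Y)).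
  move=> hX hY EUX EUY hd nXd nYd; have [_ Ed hF] := hd.
  have hrd := chamber_root hPi hE Ed.
  have nUd : ~ U d by move=> Ud; apply: nXd; exact: EUX.
  have subF C : chamber C -> ~ C d -> E `&` U `<=` C -> flip E [set d] `&` U `<=` C.
    move=> hC nCd EUC x [/flip1E[[Ex _]|->] Ux]; first exact: EUC.
    exact: (chamber_oppC hPi).
  have [||||||Z hZ [UZ ZE]] := IH (flip E [set d] `\` U) _ (flip E [set d]) erefl _ X Y => //.
  - by rewrite eA; exact: flip1_sub.
  - exact: subF.
  - exact: subF.
  by exists Z => //; exact: join_peel UZ ZE.
move=> X Y hX hY EUX EUY.
have [neX|eX] := pselect (E `\` X !=set0); last first.
  exists Y => //; split=> //; rewrite -(setD0_chamber hE hX eX).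
  rewrite setDv set0U cl_id //; exact: (closed_setD hPi).
have [neY|eY] := pselect (E `\` Y !=set0); last first.
  exists X => //; split=> //; rewrite -(setD0_chamber hE hY eY).
  rewrite setDv setU0 cl_id //; exact: (closed_setD hPi).
have [d hd nXd] := wall_exists hPi hE hX neX.
have [e he nYe] := wall_exists hPi hE hY neY.
have [eYd|nYd] := pselect (Y d); last exact: (common X Y d).
have nde : d <> e by move=> de; apply: nYe; rewrite -de.
have [_ Ed _] := hd; have [_ Ee _] := he.
have nUd : ~ U d by move=> Ud; apply: nXd; exact: EUX.
have nUe : ~ U e by move=> Ue; apply: nYe; exact: EUY.
have SEU : S d e `<=` E `\` U by apply: span2_min => //; exact: (closed_setD hPi).
have fin : finite_set (S d e) by apply: sub_finite_set SEU _; rewrite -eA.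
have hF := chamber_flip_span hPi hd he nde fin.
set F := flip E (S d e) in hF.
have EUF : E `&` U `<=` F by move=> x [Ex Ux]; left; split=> // /SEU[].
have EFS : E `\` F `<=` S d e.
  by move=> x [Ex nFx]; apply: contrapT => nSx; apply: nFx; left.
have nF x : S d e x -> ~ F x.
  move=> Sx [[_ //]|SNx]; have [Ex _] := SEU _ Sx; have [ENx _] := SEU _ SNx.
  exact: (chamber_notN hPi hE Ex).
have [|Z1 hZ1 [EUZ1 Z1E]] := common X F d hX hF EUX EUF hd nXd.
  exact/nF/(span2l hPi _ hd).
have nZ1e : ~ Z1 e.
  have : (E `\` Z1) e.
    rewrite Z1E; apply: sub_cl; right; split=> //; exact/nF/(span2r hPi _ he).
  by case.
have [Z hZ [EUZ ZE]] := common Z1 Y e hZ1 hY EUZ1 EUY he nZ1e nYe.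
exists Z => //; split=> //; have sE := chamber_sub hE.
have cT : closed (cl ((E `\` X) `|` (E `\` Y))).
  by apply: cl_closed; apply: sE => y [[]|[]].
apply: cl_eq; first exact: (closed_setD hPi).
  move=> x [hx|hx]; rewrite ZE; apply: sub_cl; [left|by right].
  by rewrite Z1E; apply: sub_cl; left.
rewrite ZE; apply: (cl_min cT) => x [hx|hx]; last by apply: sub_cl; right.
move: x hx; rewrite Z1E; apply: (cl_min cT) => x [hx|/EFS].
  by apply: sub_cl; left.
by apply: span2_min => //; apply: sub_cl; [left|right].
Qed.

(** The same statement seen from the other end of the interval. *)
Theorem meet_interval E U X Y : chamber E -> chamber U -> chamber X ->
  chamber Y -> E `&` U `<=` X -> E `&` U `<=` Y ->
  exists2 Z, chamber Z & E `&` Z = cl ((E `&` X) `|` (E `&` Y)).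
Proof.
move=> hE hU hX hY EUX EUY.
have UEX : U `&` E `<=` X by rewrite setIC.
have UEY : U `&` E `<=` Y by rewrite setIC.
have [Z hZ [EUZ ZE]] := join_interval hU hE hX hY UEX UEY.
rewrite setIC in EUZ; exists Z => //.
have cT : closed (cl ((E `&` X) `|` (E `&` Y))).
  by apply: cl_closed; apply: (chamber_sub hE) => y [[]|[]].
apply: cl_eq.
- by apply: closedI; exact: (chamber_closed hPi).
- have aux C : chamber C -> U `\` C `<=` U `\` Z -> E `&` C `<=` E `&` Z.
    move=> hC h x [Ex Cx]; split=> //; apply: contrapT => nZx.
    have hx := chamber_root hPi hE Ex.
    have [Ux|nUx] := pselect (U x); first by apply/nZx/EUZ.
    have [|_] := h (- x); last by apply; exact: (chamber_oppC hPi).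
    split; first exact: (chamber_oppC hPi).
    exact: (chamber_notN hPi hC Cx).
  move=> x [hx|hx]; [apply: (aux X hX _ x hx)|apply: (aux Y hY _ x hx)] => y hy.
    by rewrite ZE; apply: sub_cl; left.
  by rewrite ZE; apply: sub_cl; right.
- have aux C : chamber C -> E `&` U `<=` C -> U `\` C `<=` opp_set (E `&` C).
    move=> hC EUC x [Ux nCx]; have hx := chamber_root hPi hU Ux.
    split; last exact: (chamber_oppC hPi).
    by apply: (chamber_oppC hPi) => // Ex; apply/nCx/EUC.
  move=> x [Ex Zx]; have hx := chamber_root hPi hE Ex.
  have [Ux|nUx] := pselect (U x); first by apply: sub_cl; left; split=> //; exact: EUX.
  have : (U `\` Z) (- x).
    split; [exact: (chamber_oppC hPi)|exact: (chamber_notN hPi hZ Zx)].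
  rewrite ZE => h; rewrite -[x]opprK; move: (- x) h.
  apply: (cl_min (closed_opp hPi cT)) => y [/(aux X hX EUX)|/(aux Y hY EUY)] hy.
    by apply: sub_cl; left.
  by apply: sub_cl; right.
Qed.

(** Without an upper bound, walk from [X] to [Y] along a gallery that stays
    between them, so that all roots of the chambers on the way belong to [X] or
    [Y]. By induction the next chamber [X'] and [Y] have a meet. If [X'] is farther
    from [E] than [X], it bounds both [X] and this meet, and their meet in the
    interval below [X'] is the one required; otherwise nothing has to be changed. *)
Theorem meet_chamber E X Y : chamber E -> chamber X -> chamber Y ->
  exists2 Z, chamber Z & E `&` Z = cl ((E `&` X) `|` (E `&` Y)).
Proof.
move=> hE hX hY; have [A] : exists A, A = X `\` Y by exists (X `\` Y).
move=> eA; have fA : finite_set A by rewrite eA; exact: (finite_setD_chamber hPi).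
move: A fA X eA hX; apply: finite_subset_ind => A fA IH X eA hX.
have cEI C : chamber C -> closed (E `&` C).
  by move=> hC; apply: closedI; exact: (chamber_closed hPi).
have [ne|eXY] := pselect (X `\` Y !=set0); last first.
  exists Y => //; rewrite -(setD0_chamber hX hY eXY) setUid cl_id //; exact: cEI.
have [d hd nYd] := wall_exists hPi hX hY ne; have [_ Xd hF] := hd.
have hrd := chamber_root hPi hX Xd.
have YNd : Y (- d) by exact: (chamber_oppC hPi).
have [||Z1 hZ1 Z1E] := IH (flip X [set d] `\` Y) _ (flip X [set d]) erefl => //.
  by rewrite eA; exact: flip1_sub.
have sT : (E `&` X) `|` (E `&` Y) `<=` Phi by apply: (chamber_sub hE) => y [[]|[]].
have cT := cl_closed sT.
have [Ed|nEd] := pselect (E d).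
  have nEN := chamber_notN hPi hE Ed.
  have EX'X : E `&` flip X [set d] `<=` X.
    by move=> x [Ex /flip1E[[]//|xd]]; case: nEN; rewrite -xd.
  have [|Z hZ ZE] := meet_interval hE hF hX hZ1 EX'X.
    move=> x hx; have : (E `&` Z1) x by rewrite Z1E; apply: sub_cl; left.
    by case.
  exists Z => //; apply: cl_eq; first exact: cEI.
    move=> x [hx|hx]; rewrite ZE; apply: sub_cl; first by left.
    by right; rewrite Z1E; apply: sub_cl; right.
  rewrite ZE; apply: (cl_min cT) => x [hx|]; first by apply: sub_cl; left.
  rewrite Z1E; move: x; apply: (cl_min cT) => x [[Ex hx]|hx]; apply: sub_cl.
    by left; split=> //; exact: EX'X.
  by right.
have END := chamber_oppC hPi hE hrd nEd.
exists Z1 => //; apply: cl_eq; first exact: cEI.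
  move=> x [[Ex Xx]|hx]; rewrite Z1E; apply: sub_cl; [left|by right].
  by split=> //; apply/flip1E; left; split=> // xd; apply: nEd; rewrite -xd.
rewrite Z1E; apply: (cl_min cT) => x [[Ex /flip1E[[Xx _]|->]]|hx]; apply: sub_cl.
- by left.
- by right.
- by right.
Qed.

(** A gallery from [D] to [C] crosses every wall that separates them. *)
Lemma wall_between C D r : chamber C -> chamber D -> ~ C r -> D r ->
  exists2 P, wall P r & C `&` D `<=` P.
Proof.
move=> hC hD nCr; have [A] : exists A, A = D `\` C by exists (D `\` C).
move=> eA; have fA : finite_set A by rewrite eA; exact: (finite_setD_chamber hPi).
move: A fA D eA hD; apply: finite_subset_ind => A fA IH D eA hD Dr.
have [|d hd nCd] := wall_exists hPi hD hC; first by exists r.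
have [dr|ndr] := pselect (d = r); first by exists D; [rewrite -dr|move=> x []].
have [_ Dd hF] := hd.
have [|||P hP CDP] := IH (flip D [set d] `\` C) _ (flip D [set d]) erefl => //.
- by rewrite eA; exact: flip1_sub.
- by apply/flip1E; left; split=> // rd; apply: ndr.
exists P => // x [Cx Dx]; apply: CDP; split=> //; apply/flip1E; left; split=> // xd.
by apply: nCd; rewrite -xd.
Qed.

(** Here [flip Z [set r]] is the join of [G] and of the neighbour of [K] across
    [r], and the point is that it is adjacent to the wall of [r], as [K] and [U]
    are. By induction on the interval: let [e] be a first wall towards [G].
    The chamber [K'] obtained by crossing all the walls of the dihedral subsystem
    of [r] and [e] except that of [r] is again adjacent to the wall of [r], and it
    may serve as a new base, once [G] is replaced by its join with [K']. *)
Theorem wall_join K U G r : wall K r -> wall U r -> chamber G ->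
  K `&` U `<=` G ->
  exists2 Z, wall Z r &
    K `&` U `<=` Z /\ K `\` flip Z [set r] = cl ((K `\` G) `|` [set r]).
Proof.
move=> hKr hUr; have [hU Ur hUf] := hUr.
have [A] : exists A, A = K `\` U by exists (K `\` U).
move=> eA; have fA : finite_set A.
  by rewrite eA; apply: (finite_setD_chamber hPi) => //; case: hKr.
move: A fA K eA hKr G; apply: finite_subset_ind => A fA IH K eA hKr G hG KUG.
have [hK Kr hKf] := hKr; have hrr := chamber_root hPi hK Kr.
have nUNr := chamber_notN hPi hU Ur; have nKNr := chamber_notN hPi hK Kr.
have [ne|eKG] := pselect (K `\` G !=set0); last first.
  exists K => //; split; first by move=> x [].
  rewrite -(setD0_chamber hK hG eKG) setDv set0U.
  have e1 : K `\` flip K [set r] = [set r].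
    apply/seteqP; split=> [x [Kx nF]|_ ->]; last by split=> //; exact: flip1_neq.
    by apply: contrapT => nx; apply: nF; apply/flip1E; left.
  have c1 : closed [set r] by rewrite -[X in closed X]e1; exact: (closed_setD hPi).
  by rewrite e1 cl_id.
have [e hKe nGe] := wall_exists hPi hK hG ne; have [_ Ke _] := hKe.
have Gr : G r by exact: KUG.
have nre : r <> e by move=> re; apply: nGe; rewrite -re.
have nUe : ~ U e by move=> Ue; apply: nGe; exact: KUG.
have SKU : S r e `<=` K `\` flip U [set r].
  apply: span2_min; first exact: (closed_setD hPi).
    by split=> //; exact: flip1_neq.
  by split=> // /flip1E[[]//|er]; apply: nKNr; rewrite -er.
have fin : finite_set (S r e).
  by apply: sub_finite_set SKU _; exact: (finite_setD_chamber hPi).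
have hK'r := flip_spanD_wall hPi hKr hKe nre fin; have [hK' K'r _] := hK'r.
set K' := flip K (S r e `\ r) in hK'r hK' K'r.
have SU x : (S r e `\ r) x -> K x /\ ~ U x.
  move=> [/SKU[Kx nF] xr]; split=> // Ux; apply: nF; apply/flip1E.
  by left.
have SNU x : (S r e `\ r) x -> U (- x).
  move=> Sx; have [Kx nUx] := SU x Sx; apply: (chamber_oppC hPi) => //.
  exact: (chamber_root hPi hK Kx).
have K'S x : (S r e `\ r) x -> ~ K' x.
  move=> Sx [[_ //]|/SU[KNx _]]; have [Kx _] := SU x Sx.
  exact: (chamber_notN hPi hK Kx).
have KUK' : K `&` U `<=` K' by move=> x [Kx Ux]; left; split=> // /SU[].
have [G1 hG1 [KUG1 G1E]] := join_interval hK hU hG hK' KUG KUK'.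
have KK' : K `\` K' `<=` S r e `\ r.
  by move=> x [Kx nK'x]; apply: contrapT => nS; apply: nK'x; left.
have SG1 x : (S r e `\ r) x -> ~ G1 x.
  move=> Sx; have : (K `\` G1) x.
    rewrite G1E; apply: sub_cl; right; split; last exact: K'S.
    by case: (SU x Sx).
  by case.
have GG1 : K `\` G `<=` K `\` G1 by move=> x hx; rewrite G1E; apply: sub_cl; left.
have [||Z hZr [K'UZ ZE]] := IH (K' `\` U) _ K' erefl hK'r G1 hG1.
- rewrite eA; split=> [x [[[Kx _]//|/SNU Ux] nUx]|h].
    by case: nUx; rewrite -[x]opprK.
  have Se : (S r e `\ r) e by split; [exact: (span2r hPi _ hKe)|move=> /esym].
  by have [K'e _] := h e (conj Ke nUe); exact: K'S Se K'e.
- move=> x [[[Kx nSx]|Sx] Ux]; first exact: KUG1.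
  have hx := chamber_root hPi hU Ux.
  by apply: contrapT => /(chamber_oppC hPi hG1 hx); exact: SG1.
have [hZ Zr hZf] := hZr; exists Z => //; split.
  by move=> x KUx; apply: K'UZ; split; [exact: KUK'|case: KUx].
have cT : closed (cl (K `\` G `|` [set r])).
  by apply: cl_closed; apply: (chamber_sub hK) => x [[]|->].
have Te : cl (K `\` G `|` [set r]) e by apply: sub_cl; left.
have Tr : cl (K `\` G `|` [set r]) r by apply: sub_cl; right.
apply: cl_eq; first exact: (closed_setD hPi).
  move=> x [KGx|->]; last by split=> //; exact: flip1_neq.
  have [Kx nG1x] := GG1 x KGx; split=> //.
  have [K'x|nK'x] := pselect (K' x).
    have : (K' `\` flip Z [set r]) x by rewrite ZE; apply: sub_cl; left.
    by case.
  have Sx : (S r e `\ r) x by apply: KK'.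
  have ZNx : Z (- x).
    apply: K'UZ; split; last exact: SNU.
    by right; rewrite /opp_set /= opprK.
  move=> /flip1E[[Zx _]|xr]; first exact: (chamber_notN hPi hZ Zx).
  by apply: nKNr; rewrite -xr.
move=> x [Kx nFx]; have [K'x|nK'x] := pselect (K' x); last first.
  by have [Sx _] := KK' x (conj Kx nK'x); move: x Sx {Kx nFx nK'x}; exact: span2_min.
have : (K' `\` flip Z [set r]) x by [].
rewrite ZE; move: x {Kx nFx K'x}; apply: (cl_min cT) => x [[K'x nG1x]|->//].
case: K'x => [[Kx nSx]|Sx]; last first.
  case: nG1x; rewrite -[x]opprK; apply: (chamber_oppC hPi) => //; last exact: SG1.
  by have [KNx _] := SU _ Sx; exact: (chamber_root hPi hK KNx).
have : (K `\` G1) x by [].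
rewrite G1E; move: x {Kx nSx nG1x}; apply: (cl_min cT) => x [hx|/KK'[Sx _]].
  by apply: sub_cl; left.
by move: x Sx; exact: span2_min.
Qed.

End ChamberLattice.

(** * Biclosed subsets of the union of two adjacent chambers *)

Section AdjacentChambers.
Variables (R : realType) (V : lmodType R) (B : {symmetric V}) (Pi : set V).
Hypothesis hPi : simple_roots B Pi.
Local Notation Phi := (Defs.roots B Pi).
Local Notation closed := (closed_roots B Pi).
Local Notation cl := (root_closure B Pi).
Local Notation chamber := (chamber B Pi).
Local Notation wall := (wall B Pi).
Implicit Types (C D E F G P Q U X Y Z W Gam : set V) (a : V).

(** For a wall [a] of [E]: the union and the intersection of [E] and of its
    neighbour across [a]. *)
Definition thick E a : set V := E `|` [set - a].
Definition thin E a : set V := E `\ a.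

Local Notation fb E a := (finite_biclosed B Pi (thick E a)).

Lemma wall_chamber E a : wall E a -> chamber E. Proof. by case. Qed.
Lemma wall_in E a : wall E a -> E a. Proof. by case. Qed.
Lemma wall_chamberF E a : wall E a -> chamber (flip E [set a]). Proof. by case. Qed.

Lemma wall_root E a : wall E a -> Phi a.
Proof. by move=> h; apply: (chamber_root hPi (wall_chamber h)); exact: wall_in. Qed.

Lemma wall_notN E a : wall E a -> ~ E (- a).
Proof. by move=> [hE Ea _]; exact: (chamber_notN hPi hE Ea). Qed.

Lemma wall_neqN E a : wall E a -> a <> - a.
Proof. by move=> h e; apply: (wall_notN h); rewrite -e; exact: wall_in h. Qed.

Lemma flip1K E a : wall E a -> flip (flip E [set a]) [set - a] = E.
Proof.
move=> h; apply/seteqP; split=> x.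
  move=> /flip1E[[/flip1E[[]//|xa] //]|->]; rewrite ?opprK //.
  exact: wall_in h.
move=> Ex; apply/flip1E; rewrite opprK.
have [->|nx] := pselect (x = a); [by right|left].
split; first by apply/flip1E; left.
by move=> xa; apply: (wall_notN h); rewrite -xa.
Qed.

Lemma wall_flip E a : wall E a -> wall (flip E [set a]) (- a).
Proof.
move=> h; split; first exact: wall_chamberF h.
  by apply/flip1E; right.
by rewrite flip1K //; exact: wall_chamber h.
Qed.

Lemma thick_flip E a : wall E a -> thick (flip E [set a]) (- a) = thick E a.
Proof.
move=> h; apply/seteqP; split=> x.
  move=> [/flip1E[[Ex _]|->]|->]; [by left|by right|].
  by left; rewrite opprK; exact: wall_in h.
move=> [Ex|->]; last by left; apply/flip1E; right.
have [->|nx] := pselect (x = a); first by right; rewrite /= opprK.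
by left; apply/flip1E; left.
Qed.

Lemma thin_flip E a : wall E a -> thin (flip E [set a]) (- a) = thin E a.
Proof.
move=> h; apply/seteqP; split=> x; first by move=> [/flip1E[]].
move=> [Ex nx]; split; first by apply/flip1E; left.
by move=> xa; apply: (wall_notN h); rewrite -xa.
Qed.

Lemma thick_root E a x : wall E a -> thick E a x -> Phi x.
Proof.
move=> h [|->]; first exact: (chamber_root hPi (wall_chamber h)).
by apply: (root_opp hPi); exact: wall_root h.
Qed.

Lemma thick_wall E a : wall E a -> thick E a a.
Proof. by move=> h; left; exact: wall_in h. Qed.

Lemma thick_wallN E a : thick E a (- a).
Proof. by right. Qed.

Lemma thin_opp E a x : wall E a -> Phi x -> thin E a (- x) <-> ~ thick E a x.
Proof.
move=> h hx; have hE := wall_chamber h; split.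
  move=> [ENx nx] [Ex|xa]; first exact: (chamber_notN hPi hE Ex).
  by apply: nx; rewrite xa /= opprK.
move=> nt; split.
  by apply: (chamber_oppC hPi hE hx) => Ex; apply: nt; left.
by move=> xa; apply: nt; right; rewrite /= -xa opprK.
Qed.

Lemma thick_opp E a x : wall E a -> Phi x -> thick E a (- x) <-> ~ thin E a x.
Proof.
move=> h hx; have := thin_opp h (root_opp hPi hx); rewrite opprK => -[h1 h2].
by split=> [ht /h1//|nt]; apply: contrapT => /h2.
Qed.

Lemma closed_thin E a : wall E a -> closed (thin E a).
Proof. exact: (closed_setD_wall hPi). Qed.

(** Since [a] is extreme in [E], no root outside [thick E a] can be a
    nonnegative combination of [- a] and of a root of [E]. *)
Lemma closed_thick E a : wall E a -> closed (thick E a).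
Proof.
move=> h; have hE := wall_chamber h; have [_ cE] := chamber_closed hPi hE.
have ra := wall_root h.
have key x p q : E x -> 0 <= p -> 0 <= q -> Phi (p *: x + q *: - a) ->
    thick E a (p *: x + q *: - a).
  move=> Ex p0 q0 hz; apply: contrapT => /(thin_opp h hz)[ENz nz].
  have rx := chamber_root hPi hE Ex.
  have [q00|nq0] := eqVneq q 0.
    have zE : p *: x + q *: - a = p *: x by rewrite q00; lincomb.
    rewrite zE in hz ENz; rewrite (scale_root hPi) // in ENz.
    exact: (chamber_notN hPi hE Ex).
  have qp : 0 < q by rewrite lt_def nq0.
  have qV : 0 < q^-1 by rewrite invr_gt0.
  apply: nz; apply: (wall_extreme hPi (y := x) (p := q^-1) (q := q^-1 * p) h) => //.
    by rewrite mulr_ge0 // ltW.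
  transitivity ((q^-1 * q) *: a); first by lincomb.
  by rewrite mulVf // scale1r.
split; first by move=> x; exact: thick_root h.
move=> x y [Ex|->] [Ey|->] p q p0 q0 hz.
- by left; apply: cE.
- exact: key.
- by rewrite addrC; apply: key => //; rewrite addrC.
- right; rewrite /= -scalerDl (scale_root hPi) ?addr_ge0 ?scalerDl //.
  exact: (root_opp hPi).
Qed.

(** The closed sets [Q] whose complements in [thick E a] will turn out to be its
    finite biclosed subsets, for every [E] with wall [a]. *)
Definition cell a Q := chamber Q \/
  exists2 C, wall C a & Q = thick C a \/ Q = thin C a.

Definition dual_cell Q : set V := [set x | Phi x /\ ~ Q (- x)].

Lemma cell_closed a Q : cell a Q -> closed Q.
Proof.
move=> [hQ|[C hC [->|->]]]; first exact: (chamber_closed hPi).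
  exact: closed_thick.
exact: closed_thin.
Qed.

Lemma dual_cellP a Q : cell a Q -> cell a (dual_cell Q).
Proof.
move=> [hQ|[C hC [->|->]]].
- left; suff -> : dual_cell Q = Q by [].
  apply/seteqP; split=> x.
    by move=> [hx nQ]; apply: contrapT => /(chamber_oppC hPi hQ hx).
  move=> Qx; split; first exact: (chamber_root hPi hQ).
  exact: (chamber_notN hPi hQ).
- right; exists C => //; right; apply/seteqP; split=> x.
    move=> [hx nt]; have := thin_opp hC (root_opp hPi hx).
    by rewrite opprK => -[_]; apply.
  move=> [Cx nx]; have hx := chamber_root hPi (wall_chamber hC) Cx.
  split=> // /(thick_opp hC hx); apply.
  by split.
- right; exists C => //; left; apply/seteqP; split=> x.
    move=> [hx nt]; have := thick_opp hC (root_opp hPi hx).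
    by rewrite opprK => -[_]; apply.
  move=> tx; have hx := thick_root hC tx.
  by split=> // /(thin_opp hC hx).
Qed.

Lemma cell_opp a Q x : cell a Q -> x <> a -> x <> - a -> Q x -> ~ Q (- x).
Proof.
move=> hQ xa xNa; case: hQ => [hQ|[C hC [->|->]]]; first exact: (chamber_notN hPi hQ).
  have hC' := wall_chamber hC.
  move=> [Cx|/xNa//] [CNx|e]; first exact: (chamber_notN hPi hC' Cx).
  by apply: xa; rewrite -[x]opprK e opprK.
by have hC' := wall_chamber hC => -[Cx _] [CNx _]; exact: (chamber_notN hPi hC' Cx).
Qed.

Lemma cell_biclosed E a Q : wall E a -> cell a Q -> fb E a (thick E a `\` Q).
Proof.
move=> hE hQ; have hE' := wall_chamber hE; split; last split.
- have fin C : chamber C -> finite_set (thick E a `\` C).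
    move=> hC; apply: (@sub_finite_set _ _ ((E `\` C) `|` [set - a])).
      by move=> x [[Ex|->] nC]; [left|right].
    by rewrite finite_setU; split;
      [exact: (finite_setD_chamber hPi)|exact: finite_set1].
  case: hQ => [hQ|[C hC [->|->]]]; first exact: fin.
    apply: sub_finite_set (fin C (wall_chamber hC)) => x [tx nt].
    by split=> // Cx; apply: nt; left.
  apply: (@sub_finite_set _ _ ((thick E a `\` C) `|` [set a])).
    move=> x [tx nt]; have [->|nx] := pselect (x = a); [by right|left].
    by split=> // Cx; apply: nt.
  by rewrite finite_setU; split; [apply: fin; exact: wall_chamber hC|exact: finite_set1].
- by move=> x [].
- have -> : thick E a `\` Q = thick E a `&` opp_set (dual_cell Q).
    apply/seteqP; split=> x [tx h]; split=> //; have hx := thick_root hE tx.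
      by split; [exact: (root_opp hPi)|rewrite opprK].
    by move: h => [_]; rewrite opprK.
  apply: closedI; first exact: closed_thick.
  by apply: (closed_opp hPi); apply: (@cell_closed a); exact: dual_cellP.
- have -> : thick E a `\` (thick E a `\` Q) = thick E a `&` Q.
    apply/seteqP; split=> x [tx h]; split=> //; last by case.
    by apply: contrapT => nQ; apply: h.
  by apply: closedI; [exact: closed_thick|exact: cell_closed hQ].
Qed.

Lemma fb_chamber E a Gam : wall E a -> fb E a Gam ->
  exists2 C, chamber C & E `\` C = E `&` Gam.
Proof.
move=> hE [fG [sG cG cLG]]; have hE' := wall_chamber hE.
have cE := chamber_closed hPi hE'.
have DE : E `\` flip E (E `&` Gam) = E `&` Gam.
  apply/seteqP; split=> x.
    by move=> [Ex nF]; apply: contrapT => nx; apply: nF; left.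
  move=> [Ex Gx]; split=> // -[[_ n]|[ENx _]]; first by apply: n; split.
  exact: (chamber_notN hPi hE' Ex).
exists (flip E (E `&` Gam)) => //.
apply: (psys_near_chamber hPi hE'); last first.
  by rewrite DE; apply: sub_finite_set fG; exact: subIsetr.
apply: (flip_psys hPi); first exact: chamber_psys.
- exact: closedI.
- exact: subIsetl.
- have -> : E `\` (E `&` Gam) = E `&` (thick E a `\` Gam); last exact: closedI.
  apply/seteqP; split=> x [Ex h]; split=> //.
    by split; [left|move=> Gx; apply: h].
  by move=> [_]; case: h.
Qed.

(** A subset is recovered from the two chambers by which it is seen from the
    two sides of the wall: these agree except possibly at the wall. *)
Lemma cell_of_chambers E a Gam C D : wall E a -> Gam `<=` thick E a ->
  chamber C -> E `\` C = E `&` Gam ->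
  chamber D -> flip E [set a] `\` D = flip E [set a] `&` Gam ->
  exists2 Q, cell a Q & Gam = thick E a `\` Q.
Proof.
move=> hE sG hC CE hD DE; have hE' := wall_chamber hE; have ra := wall_root hE.
have Ea := wall_in hE; have nEa := wall_notN hE.
have eC x : E x -> C x <-> ~ Gam x.
  move=> Ex; split=> [Cx Gx|nG]; last first.
    apply: contrapT => nC; have : (E `&` Gam) x by rewrite -CE.
    by case.
  have : (E `\` C) x by rewrite CE.
  by case.
have eD x : flip E [set a] x -> D x <-> ~ Gam x.
  move=> Fx; split=> [Dx Gx|nG]; last first.
    apply: contrapT => nD; have : (flip E [set a] `&` Gam) x by rewrite -DE.
    by case.
  have : (flip E [set a] `\` D) x by rewrite DE.
  by case.
have FNa : flip E [set a] (- a) by apply/flip1E; right.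
have Fx x : E x -> x <> a -> flip E [set a] x by move=> Ex nx; apply/flip1E; left.
have agreeE x : E x -> x <> a -> C x <-> D x.
  by move=> Ex nx; rewrite (eC x Ex) (eD x (Fx x Ex nx)).
have agree x : Phi x -> x <> a -> x <> - a -> C x <-> D x.
  move=> hx nx nNx; have [Ex|nEx] := pselect (E x); first exact: agreeE.
  have ENx := chamber_oppC hPi hE' hx nEx.
  have nxa : - x <> a by move=> e; apply: nNx; rewrite -e opprK.
  have [h1 h2] := agreeE _ ENx nxa.
  split=> h; apply: contrapT => nh.
    by apply: (chamber_notN hPi hC h); apply: h2; exact: (chamber_oppC hPi).
  by apply: (chamber_notN hPi hD h); apply: h1; exact: (chamber_oppC hPi).
have flipCD C1 D1 : chamber C1 -> chamber D1 -> C1 a -> D1 (- a) ->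
    (forall x, Phi x -> x <> a -> x <> - a -> C1 x <-> D1 x) -> flip C1 [set a] = D1.
  move=> hC1 hD1 Ca DNa ag; apply/seteqP; split=> x.
    move=> /flip1E[[Cx nx]|->//]; have hx := chamber_root hPi hC1 Cx.
    apply/(ag x hx nx) => //.
    by move=> xa; apply: (chamber_notN hPi hC1 Ca); rewrite -xa.
  move=> Dx; have hx := chamber_root hPi hD1 Dx; apply/flip1E.
  have [->|nx] := pselect (x = - a); [by right|left].
  have nxa : x <> a by move=> xa; apply: (chamber_notN hPi hD1 DNa); rewrite opprK -xa.
  by split=> //; apply/(ag x hx).
have GamE Q : (forall x, E x -> x <> a -> Q x <-> C x) ->
    (Q a <-> ~ Gam a) -> (Q (- a) <-> ~ Gam (- a)) -> Gam = thick E a `\` Q.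
  move=> hQ Qa QNa; apply/seteqP; split=> x.
    move=> Gx; have tx := sG x Gx; split=> //; case: tx => [Ex|e]; last first.
      by move: Gx; rewrite e => Gx /QNa.
    have [e|nx] := pselect (x = a); first by move: Gx; rewrite e => Gx /Qa.
    by move=> /(hQ x Ex nx) /(eC x Ex).
  move=> [[Ex|e] nQ]; last first.
    by move: nQ; rewrite e => nQ; apply: contrapT => /QNa.
  have [e|nx] := pselect (x = a).
    by move: nQ; rewrite e => nQ; apply: contrapT => /Qa.
  by apply: contrapT => /(eC x Ex) /(hQ x Ex nx).
have aNa := wall_neqN hE.
have [Ga|nGa] := pselect (Gam a); have [GNa|nGNa] := pselect (Gam (- a)).
- have nCa : ~ C a by move=> /(eC a Ea).
  have CNa := chamber_oppC hPi hC ra nCa.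
  have nDNa : ~ D (- a) by move=> /(eD _ FNa).
  have Da : D a.
    by rewrite -[a]opprK; apply: (chamber_oppC hPi hD _ nDNa); exact: (root_opp hPi).
  have eDC : flip D [set a] = C.
    by apply: flipCD => // x hx nx nNx; apply: iff_sym; exact: agree.
  have hDa : wall D a by split=> //; rewrite eDC.
  exists (thin D a); first by right; exists D => //; right.
  apply: GamE => [x Ex nx||].
  + rewrite (agreeE x Ex nx); split=> [[]//|Dx]; by split.
  + by split=> [[_ n]|n]; case: n.
  + by split=> [[/nDNa]|/(_ GNa)].
- exists C; first by left.
  apply: GamE => [x Ex nx||]; [by []|exact: eC|].
  split=> // _; apply: (chamber_oppC hPi hC ra) => /(eC a Ea); exact.
- exists D; first by left.
  apply: GamE => [x Ex nx||]; [|split=> // _|exact: eD].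
    by apply: iff_sym; exact: agreeE.
  rewrite -[a]opprK; apply: (chamber_oppC hPi hD); first exact: (root_opp hPi).
  by move=> /(eD _ FNa).
- have Ca : C a by apply/(eC a Ea).
  have DNa : D (- a) by apply/(eD _ FNa).
  have eCD : flip C [set a] = D by exact: flipCD.
  have hCa : wall C a by split=> //; rewrite eCD.
  exists (thick C a); first by right; exists C => //; left.
  apply: GamE => [x Ex nx||].
  + split=> [[//|e]|Cx]; last by left.
    by case: nEa; rewrite -e.
  + by split=> // _; left.
  + by split=> // _; right.
Qed.

Lemma fbP E a Gam : wall E a ->
  fb E a Gam <-> exists2 Q, cell a Q & Gam = thick E a `\` Q.
Proof.
move=> hE; split=> [hG|[Q hQ ->]]; last exact: cell_biclosed.
have [C hC CE] := fb_chamber hE hG.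
have hG' : fb (flip E [set a]) (- a) Gam by rewrite thick_flip.
have [D hD DE] := fb_chamber (wall_flip hE) hG'.
by apply: (cell_of_chambers hE _ hC CE hD DE); case: hG => _ [].
Qed.

Lemma fb_sub E a Gam : fb E a Gam -> Gam `<=` thick E a.
Proof. by case=> _ []. Qed.

Lemma fb_closed E a Gam : fb E a Gam -> closed Gam.
Proof. by case=> _ []. Qed.

Lemma fb_lower E a Gam : wall E a -> fb E a Gam -> ~ Gam a -> ~ Gam (- a) ->
  exists2 P, wall P a & Gam = thick E a `\` thick P a.
Proof.
move=> hE /(fbP Gam hE)[Q hQ ->] na nNa; have ra := wall_root hE.
case: hQ na nNa => [hQ|[C hC [->|->]]] na nNa.
- exfalso; have [Qa|nQa] := pselect (Q a); last by apply: na; split=> //; exact: thick_wall.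
  apply: nNa; split; first exact: thick_wallN.
  exact: (chamber_notN hPi hQ).
- by exists C.
- by exfalso; apply: na; split; [exact: thick_wall|case=> _; apply].
Qed.

Lemma fb_upper E a Gam : wall E a -> fb E a Gam -> Gam a -> Gam (- a) ->
  exists2 P, wall P a & Gam = thick E a `\` thin P a.
Proof.
move=> hE /(fbP Gam hE)[Q hQ ->] [_ na] [_ nNa]; have ra := wall_root hE.
case: hQ => [hQ|[C hC [QE|->]]]; last by exists C.
  by case: nNa; exact: (chamber_oppC hPi hQ).
by case: na; rewrite QE; exact: thick_wall.
Qed.


(** * Joins and meets of biclosed sets *)

Lemma fb_upperI E P a : wall E a -> wall P a -> fb E a (thick E a `\` thin P a).
Proof. by move=> hE hP; apply/(fbP _ hE); exists (thin P a) => //; right; exists P => //; right. Qed.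

Lemma fb_lowerI E P a : wall E a -> wall P a -> fb E a (thick E a `\` thick P a).
Proof. by move=> hE hP; apply/(fbP _ hE); exists (thick P a) => //; right; exists P => //; left. Qed.

Lemma fb_Phi E a Gam : wall E a -> fb E a Gam -> Gam `<=` Phi.
Proof. by move=> hE hG x Gx; apply: (thick_root hE); exact: fb_sub hG _ Gx. Qed.

Lemma fb_chamber_sub E a X U C D : fb E a X -> chamber C -> chamber D ->
  E `\` C = E `&` X -> E `\` D = E `&` U -> X `<=` U -> E `&` D `<=` C.
Proof.
move=> hX hC hD CE DE XU x [Ex Dx]; apply: contrapT => nCx.
have : (E `&` X) x by rewrite -CE.
move=> [_ /XU Ux]; have : (E `&` U) x by [].
by rewrite -DE => -[].
Qed.

(** As long as [- a] is avoided, the sets are contained in [E] and their join is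
    taken in the interval below a chamber. If [a] is avoided as well, the joins
    computed from the two sides of the wall coincide. *)
Lemma fb_join_half E a X Y U : wall E a -> fb E a X -> fb E a Y -> fb E a U ->
  X `<=` U -> Y `<=` U -> ~ X (- a) -> ~ Y (- a) -> fb E a (cl (X `|` Y)).
Proof.
move=> hE hX hY hU XU YU nX nY; have hE' := wall_chamber hE; have ra := wall_root hE.
have side F b : wall F b -> fb F b X -> fb F b Y -> fb F b U -> X `<=` F ->
    Y `<=` F -> exists2 Z, chamber Z & F `\` Z = cl (X `|` Y).
  move=> hF hX' hY' hU' XF YF; have hF' := wall_chamber hF.
  have [C hC CE] := fb_chamber hF hX'; have [D hD DE] := fb_chamber hF hY'.
  have [W hW WE] := fb_chamber hF hU'.
  have [||Z hZ [_ ZE]] := join_interval hPi hF' hW hC hD.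
  - exact: fb_chamber_sub hX' hC hW CE WE XU.
  - exact: fb_chamber_sub hY' hD hW DE WE YU.
  exists Z => //; rewrite ZE CE DE; congr (cl (_ `|` _)); exact: setIidr.
have subE A : fb E a A -> ~ A (- a) -> A `<=` E.
  by move=> hA nA x Ax; case: (fb_sub hA Ax) => // e; case: nA; rewrite -e.
have XE := subE X hX nX; have YE := subE Y hY nY.
have [Z hZ ZE] := side E a hE hX hY hU XE YE.
have clE : cl (X `|` Y) `<=` E by rewrite -ZE => x [].
have [Za|nZa] := pselect (Z a); last first.
  have ZNa := chamber_oppC hPi hZ ra nZa.
  apply/(fbP _ hE); exists Z; first by left.
  rewrite -ZE; apply/seteqP; split=> x [Ex nx]; first by split=> //; left.
  by split=> //; case: Ex => // e; case: nx; rewrite e.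
have na : ~ cl (X `|` Y) a by rewrite -ZE => -[].
have subF A : A `<=` E -> A `<=` cl (X `|` Y) -> A `<=` flip E [set a].
  move=> AE Acl x Ax; apply/flip1E; left; split; first exact: AE.
  by move=> e; apply: na; rewrite -e; exact: Acl.
have hF := wall_flip hE.
have [|||||Z' hZ' Z'E] := side _ _ hF; rewrite ?thick_flip //.
- by apply: subF => // x hx; apply: sub_cl; left.
- by apply: subF => // x hx; apply: sub_cl; right.
apply/(fbP _ hE); apply: (cell_of_chambers hE _ hZ _ hZ').
- by move=> x /clE Ex; left.
- by rewrite ZE; apply/esym/setIidr.
- rewrite Z'E; apply/esym/setIidr; exact: subF.
Qed.

(** If the bound contains both [a] and [- a], adding them to [X] gives again a
    biclosed set: this is the content of [wall_join]. *)
Lemma fb_add_wall E a X U : wall E a -> fb E a X -> fb E a U -> X `<=` U ->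
  U a -> U (- a) ->
  exists2 G, wall G a & cl (X `|` [set a; - a]) = thick E a `\` thin G a.
Proof.
move=> hE hX hU XU Ua UNa; have ra := wall_root hE.
have [P hP UE] := fb_upper hE hU Ua UNa.
have side F b C P' : wall F b -> wall P' b -> chamber C -> C b ->
    thick F b `\` C `<=` thick F b `\` thin P' b ->
    exists2 G, wall G b &
      cl ((thick F b `\` C) `|` [set b; - b]) = thick F b `\` thin G b.
  move=> hF hP' hC Cb CP; have hF' := wall_chamber hF.
  have [|G hG [_ GE]] := wall_join hPi hF hP' hC.
    move=> x [Fx Px]; have [->//|nx] := pselect (x = b).
    apply: contrapT => nC; have [|_] := CP x; last by apply; split.
    by split=> //; left.
  exists G => //; have hb := wall_root hF.
  have sT : (thick F b `\` C) `|` [set b; - b] `<=` Phi.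
    move=> x [[/(thick_root hF)]//|[->//|->]]; exact: (root_opp hPi).
  apply/esym/cl_eq; first exact: fb_closed (fb_upperI hF hG).
    move=> x [[tx nC]|[->|->]].
    - split=> //; case: tx => [Fx|->]; last by move=> [/(wall_notN hG)].
      have : (F `\` flip G [set b]) x by rewrite GE; apply: sub_cl; left.
      move=> [_ nf] [Gx nx]; apply: nf; apply/flip1E; by left.
    - by split; [exact: thick_wall|case=> _; apply].
    - by split; [exact: thick_wallN|move=> [/(wall_notN hG)]].
  move=> x [[Fx|->] nt]; last by apply: sub_cl; right; right.
  have : (F `\` flip G [set b]) x.
    split=> // /flip1E[//|xb]; apply: (wall_notN hF); by rewrite -xb.
  rewrite GE; apply: (cl_mono sT) => y [[Fy nC]|->]; last by right; left.
  by left; split=> //; left.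
have /(fbP _ hE)[Q hQ XE] := hX; case: hQ => [hQ|[C hC hQ]]; last first.
  exists C => //; apply/esym/cl_eq.
  - exact: fb_closed (fb_upperI hE hC).
  - move=> x [|[->|->]].
    + rewrite XE; case: hQ => -> [tx nt] //; split=> // -[Cx nx].
      by apply: nt; left.
    + by split; [exact: thick_wall|case=> _; apply].
    + by split; [exact: thick_wallN|move=> [/(wall_notN hC)]].
  - move=> x [tx nt]; apply: sub_cl; have [->|nx] := pselect (x = a).
      by right; left.
    have [->|nNx] := pselect (x = - a); first by right; right.
    left; rewrite XE; split=> //; case: hQ => -> // -[Cx|//].
    by apply: nt; split.
have [Qa|nQa] := pselect (Q a).
  by rewrite XE; apply: (side E a Q P) => //; rewrite -XE -UE.
have QNa := chamber_oppC hPi hQ ra nQa.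
have [|G hG GE] := side _ _ Q _ (wall_flip hE) (wall_flip hP) hQ QNa.
  by rewrite thick_flip // thin_flip // -XE -UE.
exists (flip G [set - a]).
  by have := wall_flip hG; rewrite opprK.
have eN : [set - a; a] = [set a; - a] :> set V by rewrite setUC.
rewrite XE; move: GE; rewrite thick_flip // opprK eN => ->.
by rewrite -(thin_flip hG) opprK.
Qed.

Theorem fb_join E a X Y U : wall E a -> fb E a X -> fb E a Y -> fb E a U ->
  X `<=` U -> Y `<=` U -> fb E a (cl (X `|` Y)).
Proof.
move=> hE hX hY hU XU YU.
have [hN|nN] := pselect (~ X (- a) /\ ~ Y (- a)).
  by case: hN => nX nY; exact: (fb_join_half hE hX hY hU).
have [hp|np] := pselect (~ X a /\ ~ Y a).
  case: hp => nX nY; rewrite -thick_flip //.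
  by apply: (fb_join_half (U := U) (wall_flip hE)); rewrite ?thick_flip ?opprK.
have XYa : (X `|` Y) a.
  by apply: contrapT => h; apply: np; split=> ?; apply: h; [left|right].
have XYNa : (X `|` Y) (- a).
  by apply: contrapT => h; apply: nN; split=> ?; apply: h; [left|right].
have XYU : X `|` Y `<=` U by move=> x [/XU|/YU].
have Ua := XYU _ XYa; have UNa := XYU _ XYNa.
have [P hP UE] := fb_upper hE hU Ua UNa.
have sXY : X `|` Y `<=` Phi by move=> x /XYU; exact: fb_Phi hU _.
have cT := cl_closed sXY.
have strip A : fb E a A -> A `<=` U -> A `<=` X `|` Y -> exists2 G, wall G a &
    [/\ thick E a `\` thick G a `<=` thick E a `\` thick P a,
        A `<=` (thick E a `\` thick G a) `|` [set a; - a]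
      & thick E a `\` thick G a `<=` cl (X `|` Y)].
  move=> hA AU AXY; have [G hG GE] := fb_add_wall hE hA hU AU Ua UNa.
  have aux : thick E a `\` thin G a `<=` U.
    rewrite -GE; apply: (cl_min (fb_closed hU)) => x [/AU//|[->//|->//]].
  have sub x : (thick E a `\` thick G a) x -> (thick E a `\` thin G a) x.
    by move=> [tx nt]; split=> // -[Gx _]; apply: nt; left.
  exists G => //; split.
  - move=> x hx; have [tx nt] := hx; split=> // -[Px|xN]; last first.
      by apply: nt; right.
    have := aux x (sub x hx); rewrite UE => -[_]; apply; split=> // xa.
    by apply: nt; rewrite xa; exact: thick_wall.
  - move=> x Ax; have : (thick E a `\` thin G a) x by rewrite -GE; apply: sub_cl; left.
    move=> [tx nt]; have [->|nx] := pselect (x = a); first by right; left.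
    have [->|nNx] := pselect (x = - a); first by right; right.
    by left; split=> // -[Gx|//]; apply: nt; split.
  - move=> x /sub; rewrite -GE; apply: (cl_min cT) => y [/AXY|[->|->]];
      by [move=> h; apply: sub_cl|apply: sub_cl].
have [|G hG [GP XG GT]] := strip X hX XU; first by move=> x; left.
have [|H hH [HP YH HT]] := strip Y hY YU; first by move=> x; right.
have hX0 := fb_lowerI hE hG; have hY0 := fb_lowerI hE hH.
have hU0 := fb_lowerI hE hP.
have nta C : wall C a -> ~ (thick E a `\` thick C a) a.
  by move=> hC [_]; apply; exact: thick_wall.
have ntNa C : ~ (thick E a `\` thick C a) (- a).
  by move=> [_]; apply; exact: thick_wallN.
have hW := fb_join_half hE hX0 hY0 hU0 GP HP (ntNa G) (ntNa H).
have WU : cl ((thick E a `\` thick G a) `|` (thick E a `\` thick H a)) `<=`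
    thick E a `\` thick P a.
  by apply: (cl_min (fb_closed hU0)) => x [/GP|/HP].
have [||Z hZ WE] := fb_lower hE hW.
- by move=> /WU; exact: nta.
- by move=> /WU; exact: ntNa.
suff -> : cl (X `|` Y) = thick E a `\` thin Z a by exact: fb_upperI.
have low A : A `<=` cl ((thick E a `\` thick G a) `|` (thick E a `\` thick H a)) ->
    A `<=` thick E a `\` thin Z a.
  by move=> h x /h; rewrite WE => -[tx nt]; split=> // -[Zx _]; apply: nt; left.
have bds : [set a; - a] `<=` thick E a `\` thin Z a.
  move=> x [->|->]; first by split; [exact: thick_wall|case=> _; apply].
  by split; [exact: thick_wallN|move=> [/(wall_notN hZ)]].
apply/esym/cl_eq; first exact: fb_closed (fb_upperI hE hZ).
  move=> x [/XG|/YH] [hx|/bds//]; apply: low x hx => x hx; apply: sub_cl.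
    by left.
  by right.
move=> x [tx nt]; have [->|nx] := pselect (x = a); first exact: sub_cl.
have [->|nNx] := pselect (x = - a); first exact: sub_cl.
have : (thick E a `\` thick Z a) x.
  by split=> // -[Zx|//]; apply: nt; split.
by rewrite -WE; move: x {tx nt nx nNx}; apply: (cl_min cT) => x [/GT|/HT].
Qed.

(** Passing to complements inside [thick E a `\` thin P a], and to opposites,
    exchanges the roles of the walls [E] and [P]. *)
Lemma fb_dual E P a X : wall E a -> wall P a -> fb E a X ->
  X `<=` thick E a `\` thin P a ->
  fb P a (opp_set ((thick E a `\` thin P a) `\` X)).
Proof.
move=> hE hP hX XU; have /(fbP _ hE)[Q hQ XE] := hX.
apply/(fbP _ hP); exists (dual_cell Q); first exact: dual_cellP.
apply/seteqP; split=> x.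
  move=> [[tNx ntNx] nX]; have hx := root_oppE hPi (thick_root hE tNx).
  split; first by apply: contrapT => /(thin_opp hP hx).
  by move=> [_]; apply; apply: contrapT => nQ; apply: nX; rewrite XE.
move=> [tx nd]; have hx := thick_root hP tx.
have QNx : Q (- x) by apply: contrapT => nQ; apply: nd; split.
have nX : ~ X (- x) by rewrite XE => -[].
split=> //; split; last by move=> /(thin_opp hP hx).
apply: contrapT => /(thin_opp hE (root_opp hPi hx)); rewrite opprK => -[Ex nxa].
have nxNa : x <> - a by move=> e; apply: (wall_notN hE); rewrite -e.
have tEx : thick E a x by left.
have Qx : Q x.
  apply: contrapT => nQ; have Xx : X x by rewrite XE.
  have [_ ntx] := XU x Xx; apply: ntx; split=> //.
  by case: tx => // e; case: nxNa.
exact: (cell_opp hQ nxa nxNa Qx QNx).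
Qed.

Lemma opp_upper E P a : wall E a -> wall P a ->
  opp_set (thick E a `\` thin P a) = thick P a `\` thin E a.
Proof.
move=> hE hP; apply/seteqP; split=> x.
  move=> [tNx nt]; have hx := root_oppE hPi (thick_root hE tNx).
  split; first by apply: contrapT => /(thin_opp hP hx).
  by move: tNx => /(thick_opp hE hx).
move=> [tx nt]; have hx := thick_root hP tx; split.
  exact/(thick_opp hE hx).
by move=> /(thin_opp hP hx).
Qed.

(** Joins from the base [P], seen from the base [E]. *)
Lemma fb_meet_bounded E P a X Y : wall E a -> wall P a -> fb E a X -> fb E a Y ->
  X `<=` thick E a `\` thin P a -> Y `<=` thick E a `\` thin P a ->
  exists2 Z, fb E a Z &
    thick E a `\` Z = cl ((thick E a `\` X) `|` (thick E a `\` Y)).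
Proof.
move=> hE hP hX hY XU YU; set U := thick E a `\` thin P a.
have hX' := fb_dual hE hP hX XU; have hY' := fb_dual hE hP hY YU.
have hU' := fb_upperI hP hE.
have sub A : opp_set (U `\` A) `<=` thick P a `\` thin E a.
  by rewrite -opp_upper // => x [].
have hW := fb_join hP hX' hY' hU' (sub X) (sub Y).
set W := cl _ in hW.
have WU : W `<=` thick P a `\` thin E a.
  by apply: (cl_min (fb_closed hU')) => x [/sub|/sub].
have hZ := fb_dual hP hE hW WU; rewrite -opp_upper // -/U in hZ.
exists (opp_set (opp_set U `\` W)) => //.
have sT : (thick E a `\` X) `|` (thick E a `\` Y) `<=` Phi.
  by move=> x [[/(thick_root hE)]|[/(thick_root hE)]].
have cT := cl_closed sT.
have ZE x : (thick E a `\` opp_set (opp_set U `\` W)) x <->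
    thick E a x /\ (U x -> W (- x)).
  rewrite /opp_set /=; split=> -[tx h]; split=> //.
    by move=> Ux; apply: contrapT => nW; apply: h; split; rewrite // opprK.
  by move=> [Ux nW]; apply: nW; apply: h; move: Ux; rewrite opprK.
apply: cl_eq.
- by case: hZ => _ [].
- by move=> x [[tx nX]|[tx nY]]; apply/ZE; split=> // Ux; apply: sub_cl;
    [left|right]; rewrite /opp_set /= opprK.
- move=> x /ZE[tx h]; have [Ux|nUx] := pselect (U x); last first.
    by apply: sub_cl; left; split=> // /XU.
  have WT : W `<=` opp_set (cl ((thick E a `\` X) `|` (thick E a `\` Y))).
    apply: (cl_min (closed_opp hPi cT)) => y [|] [[ty _] nA]; apply: sub_cl.
      by left.
    by right.
  by have := WT _ (h Ux); rewrite /opp_set /= opprK.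
Qed.

(** Both sets contain [a]: the meet of the chambers seen from [E] suffices, unless
    both also contain [- a], in which case the two sides have to be combined. *)
Lemma fb_meet_wall E a X Y : wall E a -> fb E a X -> fb E a Y -> X a -> Y a ->
  exists2 Z, fb E a Z &
    thick E a `\` Z = cl ((thick E a `\` X) `|` (thick E a `\` Y)).
Proof.
move=> hE hX hY Xa Ya; have hE' := wall_chamber hE; have ra := wall_root hE.
have side F b : wall F b -> fb F b X -> fb F b Y -> X b -> Y b ->
    exists2 Z, chamber Z & F `&` Z = cl ((F `\` X) `|` (F `\` Y)) /\ ~ Z b.
  move=> hF hX' hY' Xb Yb; have hF' := wall_chamber hF.
  have [C hC CE] := fb_chamber hF hX'; have [D hD DE] := fb_chamber hF hY'.
  have IE A K : F `\` K = F `&` A -> F `&` K = F `\` A.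
    move=> KE; apply/seteqP; split=> x [Fx h]; split=> //.
      by move=> Ax; have : (F `\` K) x by [rewrite KE|]; case.
    by apply: contrapT => nK; have : (F `&` A) x by [rewrite -KE|]; case.
  have [Z hZ ZE] := meet_chamber hPi hF' hC hD.
  rewrite (IE X C CE) (IE Y D DE) in ZE; exists Z => //; split=> // Zb.
  have : (F `&` Z) b by split=> //; exact: wall_in hF.
  rewrite ZE; have sub : (F `\` X) `|` (F `\` Y) `<=` thin F b.
    by move=> x [[Fx nA]|[Fx nA]]; split=> // e; apply: nA; rewrite e.
  by move=> /(cl_min (closed_thin hF) sub)[_]; apply.
have [Z hZ [ZE nZa]] := side E a hE hX hY Xa Ya.
have sT : (thick E a `\` X) `|` (thick E a `\` Y) `<=` Phi.
  by move=> x [[/(thick_root hE)]|[/(thick_root hE)]].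
have [[XNa YNa]|nXY] := pselect (X (- a) /\ Y (- a)); last first.
  exists (thick E a `\` Z); first by apply/(fbP _ hE); exists Z => //; left.
  have -> : thick E a `\` (thick E a `\` Z) = thick E a `&` Z.
    apply/seteqP; split=> x [tx h]; split=> //; last by case.
    by apply: contrapT => nZ; apply: h.
  have EZ x : (E `&` Z) x -> (thick E a `&` Z) x by move=> [Ex Zx]; split=> //; left.
  have ZNa := chamber_oppC hPi hZ ra nZa.
  apply: cl_eq; first by apply: closedI; [exact: closed_thick|exact: (chamber_closed hPi)].
    move=> x [[[Ex|->] nA]|[[Ex|->] nA]];
      try (by split=> //; exact: thick_wallN); apply: EZ; rewrite ZE; apply: sub_cl.
      by left.
    by right.
  move=> x [[Ex|->] Zx]; last first.
    apply: sub_cl; have [XNa|nX] := pselect (X (- a)).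
      by right; split; [exact: thick_wallN|move=> YNa; apply: nXY].
    by left; split; [exact: thick_wallN|].
  have : (E `&` Z) x by [].
  rewrite ZE; apply: (cl_mono sT) => y [[Ey nA]|[Ey nA]]; [left|right];
    by split=> //; left.
have hF := wall_flip hE.
have [|||| Z' hZ' [Z'E nZ'a]] := side _ _ hF; rewrite ?thick_flip //.
have tE A b F : wall F b -> A b -> A (- b) -> thick F b `\` A = F `\` A.
  move=> hF' Ab ANb; apply/seteqP; split=> x [tx nA]; split=> //; last by left.
  by case: tx => // e; case: nA; rewrite e.
have EF A : A a -> A (- a) -> flip E [set a] `\` A = thick E a `\` A.
  by move=> Aa ANa; rewrite -(tE A (- a)) ?thick_flip ?opprK.
rewrite !EF // in Z'E; rewrite -(tE X a E) // -(tE Y a E) // in ZE.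
set M := cl _ in ZE Z'E *.
have ME : M `<=` thick E a by rewrite -ZE => x [Ex _]; left.
have MC F K : F `&` K = M -> F `<=` thick E a ->
    F `\` K = F `&` (thick E a `\` M).
  move=> <- FE; apply/seteqP; split=> x [Fx h]; split=> //.
    by split; [exact: FE|case].
  by move=> Kx; case: h => _; apply.
exists (thick E a `\` M).
  apply/(fbP _ hE); apply: (cell_of_chambers hE _ hZ _ hZ').
  - by move=> x [].
  - by apply: MC => // x; left.
  - by apply: MC => // x Fx; rewrite -thick_flip //; left.
apply/seteqP; split=> x; first by move=> [tx nt]; apply: contrapT => nM; apply: nt.
by move=> Mx; split; [exact: ME|case].
Qed.

(** Neither [a] nor [- a] is common to both sets, so that the meet contains
    neither and corresponds to a wall [P]. A gallery between the two sets crosses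
    the wall at some [P] with the right complement; it is then lowered until it
    lies below both, by meets in the interval below the corresponding upper set. *)
Lemma fb_meet_split E a X Y : wall E a -> fb E a X -> fb E a Y ->
  ~ (X a /\ Y a) -> ~ (X (- a) /\ Y (- a)) ->
  exists2 Z, fb E a Z &
    thick E a `\` Z = cl ((thick E a `\` X) `|` (thick E a `\` Y)).
Proof.
move=> hE hX hY nXYa nXYNa; have hE' := wall_chamber hE; have ra := wall_root hE.
set M := cl _.
have sT : (thick E a `\` X) `|` (thick E a `\` Y) `<=` Phi.
  by move=> x [[/(thick_root hE)]|[/(thick_root hE)]].
have cM : closed M := cl_closed sT.
have XM : thick E a `\` X `<=` M by move=> x hx; apply: sub_cl; left.
have YM : thick E a `\` Y `<=` M by move=> x hx; apply: sub_cl; right.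
have setDDl Q : thick E a `\` (thick E a `\` Q) = thick E a `&` Q.
  apply/seteqP; split=> x [tx h]; split=> //; last by case.
  by apply: contrapT => nQ; apply: h.
have Ma : M a.
  have [Xa|nXa] := pselect (X a); last by apply: XM; split=> //; exact: thick_wall.
  by apply: YM; split; [exact: thick_wall|move=> Ya; apply: nXYa].
have MNa : M (- a).
  have [XNa|nXNa] := pselect (X (- a)); last by apply: XM; split=> //; exact: thick_wallN.
  by apply: YM; split; [exact: thick_wallN|move=> YNa; apply: nXYNa].
have nta C : wall C a -> ~ (thick E a `\` thick C a) a.
  by move=> hC [_]; apply; exact: thick_wall.
have ntNa C : ~ (thick E a `\` thick C a) (- a).
  by move=> [_]; apply; exact: thick_wallN.
(* A set containing neither root comes from a wall already. Otherwise both sets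
   come from chambers, which lie on different sides of [a]. *)
have [P hP PM] : exists2 P, wall P a & thick E a `&` thick P a `<=` M.
  have lower A : fb E a A -> thick E a `\` A `<=` M -> ~ A a -> ~ A (- a) ->
      exists2 P, wall P a & thick E a `&` thick P a `<=` M.
    move=> hA AM na nNa; have [P hP AE] := fb_lower hE hA na nNa.
    by exists P => //; rewrite -setDDl -AE.
  have between C D : chamber C -> chamber D -> ~ C a -> D a ->
      thick E a `&` C `<=` M -> thick E a `&` D `<=` M ->
      exists2 P, wall P a & thick E a `&` thick P a `<=` M.
    move=> hC hD nCa Da CM DM; have [P hP CDP] := wall_between hPi hC hD nCa Da.
    exists P => // x [tx [Px|->//]]; have hx := thick_root hE tx.
    have [Cx|nCx] := pselect (C x); first exact: CM.
    apply: DM; split=> //; apply: contrapT => nDx.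
    apply: (chamber_notN hPi (wall_chamber hP) Px); apply: CDP.
    by split; exact: (chamber_oppC hPi).
  have [nX|hXa] := pselect (~ X a /\ ~ X (- a)); first by case: nX => *; exact: (lower X).
  have [nY|hYa] := pselect (~ Y a /\ ~ Y (- a)); first by case: nY => *; exact: (lower Y).
  have /(fbP _ hE)[Q hQ XE] := hX; have /(fbP _ hE)[Q' hQ' YE] := hY.
  have chb A A' K : cell a K -> A = thick E a `\` K -> ~ (~ A a /\ ~ A (- a)) ->
      ~ (~ A' a /\ ~ A' (- a)) -> ~ (A a /\ A' a) -> ~ (A (- a) /\ A' (- a)) ->
      chamber K.
    move=> [//|[C hC [->|->]]] AE n1 n2 n3 n4; exfalso.
      by apply: n1; rewrite AE; split; [exact: nta|exact: ntNa].
    apply: n2; split=> hA'; [apply: n3|apply: n4]; split=> //; rewrite AE.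
      by split; [exact: thick_wall|case=> _; apply].
    by split; [exact: thick_wallN|move=> [/(wall_notN hC)]].
  have hC : chamber Q by apply: (chb X Y).
  have hD : chamber Q' by apply: (chb Y X) => // -[h1 h2]; [apply: nXYa|apply: nXYNa].
  have CM : thick E a `&` Q `<=` M by rewrite -setDDl -XE.
  have DM : thick E a `&` Q' `<=` M by rewrite -setDDl -YE.
  have inA A K : A = thick E a `\` K -> chamber K ->
      (K a -> A (- a)) /\ (~ K a -> A a).
    move=> -> hK; split=> h; last by split=> //; exact: thick_wall.
    by split; [exact: thick_wallN|exact: (chamber_notN hPi)].
  have [QX nQX] := inA X Q XE hC; have [QY nQY] := inA Y Q' YE hD.
  have [Qa|nQa] := pselect (Q a); have [Qa'|nQa'] := pselect (Q' a).
  - by case: nXYNa; split; [exact: QX|exact: QY].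
  - exact: (between Q' Q).
  - exact: (between Q Q').
  - by case: nXYa; split; [exact: nQX|exact: nQY].
(* As long as the set [A] of the wall is not below both, its meet with one of them
   is a smaller set of the same sort. *)
have [A] : exists A, A = thick E a `\` thick P a by exists (thick E a `\` thick P a).
move=> eA; have fA : finite_set A by rewrite eA; case: (fb_lowerI hE hP).
move: A fA P eA hP PM; apply: finite_subset_ind => A fA IH P eA hP PM.
have hp := fb_lowerI hE hP; have Pa := wall_in hP.
have [[pX pY]|np] := pselect (A `<=` X /\ A `<=` Y).
  exists A; rewrite eA // setDDl.
  apply: cl_eq => //; first by apply: closedI; exact: closed_thick.
  have aux C : A `<=` C -> thick E a `\` C `<=` thick E a `&` thick P a.
    move=> sAC x [tx nC]; split=> //; apply: contrapT => nt; apply: nC; apply: sAC.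
    by rewrite eA.
  by move=> x [/(aux _ pX)|/(aux _ pY)].
suff low C : fb E a C -> thick E a `\` C `<=` M -> ~ (A `<=` C) ->
    exists2 Z, fb E a Z & thick E a `\` Z = M.
  have [pX|npX] := pselect (A `<=` X); last exact: (low X).
  by apply: (low Y) => // pY; apply: np.
move=> hC CM nAC; have [K hK KE] := fb_chamber hE hC.
have [Z' hZ' Z'E] := meet_chamber hPi hE' hK (wall_chamber hP).
have KC x : E x -> K x <-> ~ C x.
  move=> Ex; split=> [Kx Cx|nC].
    have : (E `&` C) x by [].
    by rewrite -KE => -[].
  apply: contrapT => nK; have : (E `\` K) x by [].
  by rewrite KE => -[].
have EZM : E `&` Z' `<=` M.
  rewrite Z'E; apply: (cl_min cM) => x [[Ex Kx]|[Ex Px]].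
    by apply: CM; split; [left|exact/KC].
  by apply: PM; split; left.
have PZ : E `&` P `<=` Z'.
  by move=> x hx; have : (E `&` Z') x by [rewrite Z'E; apply: sub_cl; right|]; case.
have hZc : fb E a (thick E a `\` Z') by apply/(fbP _ hE); exists Z' => //; left.
have [||Z hZ ZE] := fb_meet_bounded hE hP hp hZc.
- by move=> x [tx nt]; split=> // -[Px _]; apply: nt; left.
- move=> x [[Ex|->] nZ]; split.
  + by left.
  + by move=> [Px _]; apply: nZ; apply: PZ.
  + exact: thick_wallN.
  + by move=> [/(wall_notN hP)].
rewrite !setDDl in ZE.
have ZM : thick E a `\` Z `<=` M.
  rewrite ZE; apply: (cl_min cM) => x [/PM//|[[Ex|->] Zx]//]; exact: EZM.
have ZA : Z `<=` A.
  move=> x Zx; have tx := fb_sub hZ Zx; rewrite eA; split=> // tPx.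
  have : (thick E a `\` Z) x by rewrite ZE; apply: sub_cl; left.
  by case.
have [||P' hP' ZP'] := fb_lower hE hZ.
- by move=> /ZA; rewrite eA; exact: nta.
- by move=> /ZA; rewrite eA; exact: ntNa.
apply: (IH Z _ P' ZP' hP'); last by rewrite -setDDl -ZP'.
split=> // AZ; apply: nAC => x Ax; apply: contrapT => nCx.
have Zx := AZ x Ax; move: Ax; rewrite eA => -[[Ex|->] nt]; last first.
  by apply: nt; exact: thick_wallN.
have : (thick E a `\` Z) x.
  rewrite ZE; apply: sub_cl; right; split; first by left.
  have : (E `&` Z') x by rewrite Z'E; apply: sub_cl; left; split=> //; exact/KC.
  by case.
by case.
Qed.

Theorem fb_meet E a X Y : wall E a -> fb E a X -> fb E a Y ->
  exists2 Z, fb E a Z &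
    thick E a `\` Z = cl ((thick E a `\` X) `|` (thick E a `\` Y)).
Proof.
move=> hE hX hY.
have [[Xa Ya]|nXY] := pselect (X a /\ Y a); first exact: fb_meet_wall.
have [[XNa YNa]|nXYN] := pselect (X (- a) /\ Y (- a)); last exact: fb_meet_split.
have := @fb_meet_wall (flip E [set a]) (- a) X Y (wall_flip hE).
by rewrite thick_flip //; apply.
Qed.

End AdjacentChambers.

(** * Arbitrary joins and meets *)

Section Families.
Variables (R : realType) (V : lmodType R) (B : {symmetric V}) (Pi : set V).
Hypothesis hPi : simple_roots B Pi.
Local Notation Phi := (Defs.roots B Pi).
Local Notation closed := (closed_roots B Pi).
Local Notation cl := (root_closure B Pi).
Variables (E : set V) (a : V).
Hypothesis hE : wall B Pi E a.
Local Notation Lam := (thick E a).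
Local Notation L := (finite_biclosed B Pi Lam).
Implicit Types (Gam : set V) (Y : set (set V)).

Lemma fb_set0 : L set0.
Proof.
have c0 : closed set0 by split.
by split; [exact: finite_set0|split; rewrite ?setD0 //; exact: closed_thick].
Qed.

Lemma is_meet_inj (M : set (set V)) Y D D' :
  is_meet M Y D -> is_meet M Y D' -> D = D'.
Proof. by move=> [h1 h2 h3] [h1' h2' h3']; apply/seteqP; split; [exact: h3'|exact: h3]. Qed.

Lemma is_join_inj (M : set (set V)) Y D D' :
  is_join M Y D -> is_join M Y D' -> D = D'.
Proof. by move=> [h1 h2 h3] [h1' h2' h3']; apply/seteqP; split; [exact: h3|exact: h3']. Qed.

(** Below a finite bound, finitely many binary joins exhaust the family. *)
Lemma fb_join_family Y U : Y `<=` L -> L U -> (forall Gam, Y Gam -> Gam `<=` U) ->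
  is_join L Y (cl (\bigcup_(Gam in Y) Gam)).
Proof.
move=> YL LU YU; set T := cl _.
have YT : \bigcup_(Gam in Y) Gam `<=` T by exact: sub_cl.
have bU : \bigcup_(Gam in Y) Gam `<=` U by move=> x [Gam YG Gx]; exact: YU YG x Gx.
have cT : closed T by apply: cl_closed => x /bU; exact: (fb_Phi hPi hE LU).
suff LT : L T.
  split=> // [Gam YG x Gx|C LC YC]; first by apply: YT; exists Gam.
  by apply: (cl_min (fb_closed LC)) => x [Gam YG Gx]; exact: YC YG x Gx.
suff gen D : finite_set D -> forall A, L A -> A `<=` T -> U `\` A = D -> L T.
  by apply: (gen _ (finite_setD set0 LU.1) set0 fb_set0).
move: D; apply: finite_subset_ind => D fD IH A LA AT eD.
have [YA|nYA] := pselect (\bigcup_(Gam in Y) Gam `<=` A).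
  suff -> : T = A by [].
  by apply/seteqP; split=> //; exact: cl_min (fb_closed LA) YA.
have [x [[Gam YG Gx] nAx]] : exists x, (\bigcup_(Gam in Y) Gam) x /\ ~ A x.
  by apply: contrapT => h; apply: nYA => x hx; apply: contrapT => nA; apply: h; exists x.
have TU : T `<=` U by exact: cl_min (fb_closed LU) bU.
have AU := subset_trans AT TU.
have AGT : A `|` Gam `<=` T by move=> y [/AT//|Gy]; apply: YT; exists Gam.
apply: (IH _ _ (cl (A `|` Gam))) => //.
- rewrite -eD; split=> [y [Uy nA]|h].
    by split=> // Ay; apply: nA; apply: sub_cl; left.
  have [|_] := h x; last by apply; apply: sub_cl; right.
  by split=> //; exact: YU YG x Gx.
- exact: (fb_join hPi hE LA (YL _ YG) LU AU (YU _ YG)).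
- exact: cl_min cT AGT.
Qed.

(** Finitely many binary meets, starting from any member, exhaust the family. *)
Lemma fb_meet_family Y : Y `<=` L -> Y !=set0 ->
  exists2 D, is_meet L Y D & Lam `\` D = cl (\bigcup_(Gam in Y) (Lam `\` Gam)).
Proof.
move=> YL [G0 YG0]; set T := cl _.
have YT : \bigcup_(Gam in Y) (Lam `\` Gam) `<=` T by exact: sub_cl.
have cT : closed T.
  by apply: cl_closed => x [Gam YG [tx _]]; exact: (thick_root hPi hE tx).
suff [D LD DE] : exists2 D, L D & Lam `\` D = T.
  have sub C : L C -> (forall Gam, Y Gam -> C `<=` Gam) -> C `<=` D.
    move=> LC CY x Cx; apply: contrapT => nD.
    have : T x by rewrite -DE; split=> //; exact: fb_sub LC x Cx.
    have cLC : closed (Lam `\` C) by case: LC => _ [].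
    move=> /(cl_min cLC) h; have [|_] := h; last by [].
    by move=> y [Gam YG [ty nG]]; split=> // /(CY _ YG).
  exists D => //; split=> // Gam YG x Dx; apply: contrapT => nG.
  have : T x by apply: YT; exists Gam => //; split=> //; exact: fb_sub LD x Dx.
  by rewrite -DE => -[].
suff gen D : finite_set D -> L D -> Lam `\` D `<=` T -> exists2 D, L D & Lam `\` D = T.
  have LG0 := YL _ YG0; apply: (gen _ LG0.1 LG0) => x hx.
  by apply: YT; exists G0.
move: D; apply: finite_subset_ind => D fD IH LD DT.
have [DY|nDY] := pselect (forall Gam, Y Gam -> D `<=` Gam).
  exists D => //; apply/seteqP; split=> //.
  have cLD : closed (Lam `\` D) by case: LD => _ [].
  by apply: (cl_min cLD) => x [Gam YG [tx nG]]; split=> // /(DY _ YG).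
have [Gam [x [YG Dx nGx]]] : exists Gam x, [/\ Y Gam, D x & ~ Gam x].
  apply: contrapT => h; apply: nDY => Gam YG x Dx; apply: contrapT => nG.
  by apply: h; exists Gam, x.
have [Z LZ ZE] := fb_meet hPi hE LD (YL _ YG).
apply: (IH Z) => //.
- split=> [y Zy|h].
    apply: contrapT => nD; have : (Lam `\` Z) y.
      by rewrite ZE; apply: sub_cl; left; split=> //; exact: fb_sub LZ y Zy.
    by case.
  have : (Lam `\` Z) x.
    by rewrite ZE; apply: sub_cl; right; split=> //; exact: fb_sub LD x Dx.
  by move=> [_]; apply; exact: h.
- by rewrite ZE; apply: (cl_min cT) => y [/DT//|hy]; apply: YT; exists Gam.
Qed.

(** * Restriction to the wall *)

(** The only roots that are combinations of [a] and [- a] are these two. *)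
Lemma closed_sub_wall Gam : Gam `<=` [set a; - a] -> closed Gam.
Proof.
move=> sG; have ra := wall_root hPi hE.
have rt x : [set a; - a] x -> Phi x by move=> [->|->] //; exact: root_opp.
split; first by move=> x /sG/rt.
move=> x y Gx Gy p q p0 q0 hz.
have same u t : [set a; - a] u -> 0 <= t -> Phi (t *: u) -> t *: u = u.
  by move=> /rt hu; exact: (scale_root hPi hu).
have [xy|nxy] := pselect (x = y).
  have zE : p *: x + q *: y = (p + q) *: x by rewrite xy; lincomb.
  by rewrite zE in hz *; rewrite (same _ _ (sG _ Gx)) ?addr_ge0.
have yx : y = - x.
  case: (sG _ Gx) (sG _ Gy) nxy => -> [] -> //; rewrite ?opprK //.
have [pq|qp] := leP q p.
  have zE : p *: x + q *: y = (p - q) *: x by rewrite yx; lincomb.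
  by rewrite zE in hz *; rewrite (same _ _ (sG _ Gx)) ?subr_ge0.
have zE : p *: x + q *: y = (q - p) *: y by rewrite yx; lincomb.
by rewrite zE in hz *; rewrite (same _ _ (sG _ Gy)) // subr_ge0 ltW.
Qed.

Lemma fb_wallP Gam :
  finite_biclosed B Pi [set a; - a] Gam <-> Gam `<=` [set a; - a].
Proof.
split=> [[_ []//]|sG]; split.
  by apply: sub_finite_set sG _; rewrite finite_setU; split; exact: finite_set1.
by split=> //; apply: closed_sub_wall => // x [].
Qed.

(** Removing [a] or [- a] from the union of the two chambers leaves one of
    them, so the closure never creates [a] nor [- a]. *)
Lemma cl_wall Gam x : Gam `<=` Lam -> [set a; - a] x -> cl Gam x -> Gam x.
Proof.
move=> GL hx; apply: contraPP => nGx.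
have h C : chamber B Pi C -> Gam `<=` C -> ~ C x -> ~ cl Gam x.
  by move=> hC GC nC /(cl_min (chamber_closed hPi hC) GC).
have GxN y : Gam y -> y <> x by move=> Gy yx; apply: nGx; rewrite -yx.
case: hx => xE; rewrite xE in h GxN *.
  apply: (h _ (wall_chamberF hE)); last exact: (flip1_neq hPi hE).
  move=> y Gy; apply/flip1E; case: (GL y Gy) => [Ey|->]; last by right.
  by left; split=> //; exact: GxN.
apply: (h _ (wall_chamber hE)); last exact: (wall_notN hPi hE).
by move=> y Gy; case: (GL y Gy) => // yE; case: (GxN y Gy).
Qed.

End Families.

(** * Rank one parabolic subgroups *)

Section RankOne.
Variables (R : realType) (V : lmodType R) (B : {symmetric V}) (Pi : set V).
Hypothesis hPi : simple_roots B Pi.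
Local Notation Phi := (Defs.roots B Pi).
Local Notation Pos := (positive_roots B Pi).
Local Notation s := (reflection B).

Lemma generated_involution (f g : V -> V) : involutive f ->
  generated [set f] g -> g = id \/ g = f.
Proof.
move=> fK; apply: (@smallest_sub _ _ _ [set g | g = id \/ g = f]).
  split; first by left.
  - move=> _ _ [->|->] [->|->]; [by left|by right|by right|left].
    by apply/funext => x /=; rewrite fK.
  - move=> _ h [->|->] hK _; [left|right]; apply/funext => x.
      exact: (hK x).
    by rewrite -[in LHS](fK x) hK.
by move=> _ ->; right.
Qed.

(** A reflection in the subgroup is not the identity, hence is [s a], and it
    determines its root up to sign. *)
Lemma roots_of_simple a : Pi a -> roots_of B Pi [set s a] = [set a; - a].
Proof.
move=> Pa; have a1 := simple_norm hPi Pa; have ra := simple_root hPi Pa.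
apply/seteqP; split=> b.
  move=> [rb] /(generated_involution (reflectionK a1)) [] e.
    have := congr1 (fun f => f b) e; rewrite (reflection_self (root_norm hPi rb)) => bN.
    exfalso; apply: (root0 hPi); suff <- : b = 0 by [].
    have : (1 + 1) *: b = 0 by rewrite scalerDl scale1r -{1}bN addNr.
    by move=> /eqP; rewrite scaler_eq0 -mulr2n pnatr_eq0 /= => /eqP.
  have := congr1 (fun f => f b) e; rewrite (reflection_self (root_norm hPi rb)) => bN.
  have bE : b = B b a *: a.
    have : (1 + 1) *: b = (1 + 1) *: (B b a *: a).
      transitivity (b - - b); first by lincomb.
      by rewrite bN /reflection; lincomb.
    by apply: scalerI; rewrite -mulr2n pnatr_eq0.
  have [t0|t0] := leP 0 (B b a).
    by left; rewrite /= bE; apply: (scale_root hPi) => //; rewrite -bE.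
  right; have bE' : b = (- B b a) *: - a by rewrite {1}bE; lincomb.
  rewrite /= bE'; apply: (scale_root hPi); [exact: root_opp| |by rewrite -bE'].
  by rewrite oppr_ge0 ltW.
have hs : generated [set s a] (s a) by move=> G [_ hG]; exact: hG.
move=> [->|->]; split=> //; first exact: root_opp.
suff -> : s (- a) = s a by [].
by apply/funext => v; rewrite /reflection form_sym form_oppl form_sym; lincomb.
Qed.

Lemma Lambda_of_simple a : Pi a -> Lambda_of B Pi [set s a] = thick Pos a.
Proof.
move=> Pa; rewrite /Lambda_of roots_of_simple //; apply/seteqP; split=> x.
  by move=> [px|[->|->]]; [left|left; exact: simple_pos|right].
by move=> [px|->]; [left|right; right].
Qed.

Lemma wall_pos a : Pi a -> wall B Pi Pos a.
Proof. by move=> Pa; apply: (wall_word hPi (w := [::])). Qed.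

End RankOne.

Theorem theorem1p13 (R : realType) (V : lmodType R) (B : {symmetric V})
    (Pi : set V) (hPi : simple_roots B Pi)
    (J : set (V -> V)) (hJS : J `<=` simple_reflections B Pi)
    (hJ1 : J #= `I_1) :
  let cl := root_closure B Pi in
  let Lambda := Lambda_of B Pi J in
  let L := calL B Pi J in
  let PhiJ := roots_of B Pi J in
  let tauJ := tau B Pi J in
  complete_meet_semilattice L
  /\
  (forall Y : set (set V), Y `<=` L ->
     (exists2 Upp, L Upp & forall Gamma, Y Gamma -> Gamma `<=` Upp) ->
     is_join L Y (cl (\bigcup_(Gamma in Y) Gamma)))
  /\
  (forall Y : set (set V), Y `<=` L -> Y !=set0 ->
     forall Delta, is_meet L Y Delta ->
       Lambda `\` Delta = cl (\bigcup_(Gamma in Y) (Lambda `\` Gamma)))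
  /\
  [/\ lattice (finite_biclosed B Pi PhiJ),
      forall Gamma, L Gamma -> finite_biclosed B Pi PhiJ (tauJ Gamma),
      forall (Y : set (set V)) Delta, Y `<=` L -> Y !=set0 ->
        is_meet L Y Delta ->
        is_meet (finite_biclosed B Pi PhiJ) (tauJ @` Y) (tauJ Delta),
      forall (Y : set (set V)) Delta, Y `<=` L ->
        is_join L Y Delta ->
        is_join (finite_biclosed B Pi PhiJ) (tauJ @` Y) (tauJ Delta)
    & forall Gamma, Gamma `<=` Lambda -> tauJ (cl Gamma) = cl (tauJ Gamma)].
Proof.
have [a Pa JE] : exists2 a, Pi a & J = [set reflection B a].
  have [f [fJ finj fsurj]] := card_set_bijP hJ1.
  have [g Jg _] := fsurj 0%N erefl; have [a Pa aE] := hJS g Jg.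
  have f0 h : J h -> f h = 0%N by move=> /fJ; rewrite /= ltnS leqn0 => /eqP.
  exists a => //; rewrite aE; apply/seteqP; split=> [h Jh|_ ->//].
  by apply: finj; rewrite ?inE // !f0.
move=> cl Lambda L PhiJ tauJ.
have PhiJE : PhiJ = [set a; - a] by rewrite /PhiJ JE; exact: roots_of_simple.
have LambdaE : Lambda = thick (positive_roots B Pi) a.
  by rewrite /Lambda JE; exact: Lambda_of_simple.
have hE := wall_pos hPi Pa.
have LE : L = finite_biclosed B Pi (thick (positive_roots B Pi) a).
  by rewrite /L /calL -LambdaE.
have tauE Gam : tauJ Gam = Gam `&` [set a; - a] by rewrite /tauJ /tau -PhiJE.
have fbJ Gam := fb_wallP hPi hE Gam; rewrite -PhiJE in fbJ.
have tau_sub Gam : tauJ Gam `<=` PhiJ by move=> x [].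
have meetE Y : Y `<=` L -> Y !=set0 -> exists2 D, is_meet L Y D &
    Lambda `\` D = cl (\bigcup_(Gam in Y) (Lambda `\` Gam)).
  by rewrite LE LambdaE; exact: fb_meet_family.
have joinE Y U : Y `<=` L -> L U -> (forall Gam, Y Gam -> Gam `<=` U) ->
    is_join L Y (cl (\bigcup_(Gam in Y) Gam)).
  by rewrite LE; exact: fb_join_family.
have clJ Gam x : Gam `<=` Lambda -> PhiJ x -> cl Gam x -> Gam x.
  by rewrite PhiJE LambdaE; exact: (cl_wall hPi hE).
have sLam Gam : L Gam -> Gam `<=` Lambda by move=> [_ []].
have JLam : PhiJ `<=` Lambda by move=> x hx; right.
split; first by move=> Y YL Y0; have [D hD _] := meetE Y YL Y0; exists D.
split; first by move=> Y YL [U LU YU]; exact: joinE YL LU YU.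
have meetC Y D : Y `<=` L -> Y !=set0 -> is_meet L Y D ->
    Lambda `\` D = cl (\bigcup_(Gam in Y) (Lambda `\` Gam)).
  by move=> YL Y0 hD; have [D' hD' <-] := meetE Y YL Y0; rewrite (is_meet_inj hD hD').
split; first by move=> Y YL Y0 D; exact: meetC.
split.
- move=> A C /fbJ sA /fbJ sC; split.
    exists (A `&` C); split; first by apply/fbJ => x [/sA].
      by move=> D [->|->] x [].
    by move=> D _ hD x Dx; split; apply: hD Dx; [left|right].
  exists (A `|` C); split; first by apply/fbJ => x [/sA|/sC].
    by move=> D [->|->] x; [left|right].
  by move=> D _ hD x [Ax|Cx]; [apply: (hD A)|apply: (hD C)] => //; [left|right].
- by move=> Gam _; apply/fbJ.
- move=> Y D YL Y0 hD; have DE := meetC Y D YL Y0 hD; have [LD DY _] := hD.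
  split; first exact/fbJ.
    by move=> _ [Gam YG <-] x [Dx Jx]; split=> //; exact: DY YG x Dx.
  move=> C /fbJ sC CY x Cx; have Jx := sC x Cx; split=> //.
  apply: contrapT => nDx; have : cl (\bigcup_(Gam in Y) (Lambda `\` Gam)) x.
    by rewrite -DE; split=> //; exact: JLam.
  move=> hx; have [|Gam YG [_ nG]] := clJ _ x _ Jx hx.
    by move=> y [Gam _ []].
  by apply: nG; have [] := CY (tauJ Gam) (imageP _ YG) x Cx.
- move=> Y D YL hD; have [LD YD Dmin] := hD.
  have DE := is_join_inj hD (joinE Y D YL LD YD).
  split; first exact/fbJ.
    by move=> _ [Gam YG <-] x [Gx Jx]; split=> //; exact: YD YG x Gx.
  move=> C _ YC x [Dx Jx]; rewrite DE in Dx.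
  have [|Gam YG Gx] := clJ _ x _ Jx Dx; first by move=> y [Gam /YL/sLam]; apply.
  by apply: (YC (tauJ Gam)); [exact: imageP|split].
- move=> Gam sG; have -> : cl (tauJ Gam) = tauJ Gam.
    apply: cl_id; rewrite tauE; apply: (closed_sub_wall hPi hE); exact: subIsetr.
  by apply/seteqP; split=> x [Gx Jx]; split=> //; [exact: clJ Gx|exact: sub_cl].
Qed.
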